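(* Let $\{v_1,\ldots,v_n\}$ be a basis of $\mathbb{R}^n$ and let $C=\mathbb{R}_{\geq 0}\cdot v_1+\cdots+\mathbb{R}_{\geq 0}\cdot v_n$ be the corresponding positive convex cone. Let $\mu$ be a positive Borel measure on $\mathbb{R}^n$ which is supported in $C$. Suppose $R>0$ and a non-decreasing function $\rho:(R,\infty)\to\mathbb{R}_{\geq 0}$ of class $C^1$ are such that $$\int_{R}^\infty\frac{\rho(s)}{s^2}\,ds=\infty$$ and $$\int_{\sqrt{\Vert x\Vert}>R} \exp\left(\int_{R}^{\sqrt{\Vert x\Vert}}\frac{\rho(s)}{s}\,ds\right)d\mu(x)<\infty.$$ Then $\mu$ is $C$-determinate.
   Context: $\Vert\cdot\Vert$ is the standard Euclidean norm on $\mathbb{R}^n$. $\mathcal{M}^*$ is the set of all positive Borel measures $\mu$ on $\mathbb{R}^n$ such that $\int_{\mathbb{R}^n}\Vert x\Vert^d\,d\mu(x)<\infty$ for all $d\ge 0$. A measure $\mu$ supported in $C$ is $C$-determinate if $\mu\in\mathcal{M}^*$ and every $\nu\in\mathcal{M}^*$ which is also supported in $C$ and satisfies $\int_C P\,d\nu=\int_C P\,d\mu$ for all polynomials $P$ on $\mathbb{R}^n$ is equal to $\mu$.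
   Formalization: The positive Borel measure μ is assumed finite on compact sets; otherwise an infinite point mass at the origin satisfies all hypotheses but is not in M^*, hence not C-determinate. *)

(* Defs.v *)
From mathcomp Require Import all_boot all_order all_algebra.
From mathcomp Require Import all_classical all_reals all_analysis.
From mathcomp Require mpoly.

Set Implicit Arguments.
Unset Strict Implicit.
Unset Printing Implicit Defensive.

Import Order.TTheory GRing.Theory Num.Theory.
Import numFieldNormedType.Exports.

Local Open Scope classical_set_scope.
Local Open Scope ring_scope.

(* R^n with its Borel sigma-algebra; the topology on ['rV[R]_n] is that of the
   sup norm, i.e. the usual one. *)
Notation borelRn R n := (g_sigma_algebraType (@open 'rV[R]_n)).

(* The norm that the library puts on ['rV[R]_n] is the sup norm. *)
Definition euclidean_norm (R : realType) (n : nat) (x : 'rV[R]_n) : R :=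
  Num.sqrt (\sum_(i < n) x ord0 i ^+ 2).

Definition positive_cone (R : realType) (n : nat) (v : n.-tuple 'rV[R]_n) :
    set 'rV[R]_n :=
  [set x | exists2 a : 'I_n -> R,
     (forall i, 0 <= a i) & x = \sum_(i < n) a i *: tnth v i].

(* Part of the usual convention for a positive Borel measure on R^n, but not of
   the library's [measure]: an infinite point mass at the origin is excluded. *)
Definition locally_finite (R : realType) (n : nat)
    (mu : {measure set (borelRn R n) -> \bar R}) : Prop :=
  forall K : set 'rV[R]_n, compact K -> (mu K < +oo)%E.

(* For a closed set [C], this says that the topological support of [mu] is
   contained in [C]. *)
Definition supported_in (R : realType) (n : nat) (C : set 'rV[R]_n)
    (mu : {measure set (borelRn R n) -> \bar R}) : Prop :=
  mu (~` C) = 0%E.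

Definition Mstar (R : realType) (n : nat)
    (mu : {measure set (borelRn R n) -> \bar R}) : Prop :=
  forall d : R, 0 <= d ->
    (\int[mu]_x (euclidean_norm x `^ d)%:E < +oo)%E.

Definition polyfun (R : realType) (n : nat) (P : mpoly.mpoly n R)
    (x : 'rV[R]_n) : R :=
  mpoly.meval (fun i => x ord0 i) P.

(* Two measures are compared on Borel sets only: a library measure also takes
   (irrelevant) values on the other sets. *)
Definition determinate (R : realType) (n : nat) (C : set 'rV[R]_n)
    (mu : {measure set (borelRn R n) -> \bar R}) : Prop :=
  [/\ supported_in C mu, Mstar mu &
    forall nu : {measure set (borelRn R n) -> \bar R},
      Mstar nu -> supported_in C nu ->
      (forall P : mpoly.mpoly n R,
        (\int[nu]_(x in C) (polyfun P x)%:E =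
         \int[mu]_(x in C) (polyfun P x)%:E)%E) ->
      forall A : set (borelRn R n), measurable A -> nu A = mu A].

(* Only the values of [f] on the open interval [`]r, +oo[] matter. *)
Definition C1_after (R : realType) (r : R) (f : R -> R) : Prop :=
  {in `]r, +oo[, forall s, derivable f s 1} /\
  {in `]r, +oo[, continuous (derive1 f)}.

(* Main.v *)
Require Import Defs.
From mathcomp Require Import all_boot all_order all_algebra.
From mathcomp Require Import all_classical all_reals all_analysis.
From mathcomp Require Import measurable_realfun.
From mathcomp Require Import ring lra.
From mathcomp Require mpoly.

Set Implicit Arguments.
Unset Strict Implicit.
Unset Printing Implicit Defensive.

Import Order.TTheory GRing.Theory Num.Theory.
Import numFieldNormedType.Exports.

Local Open Scope classical_set_scope.
Local Open Scope ring_scope.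

(** Restricted to the cone, [mu] and [nu] have the same moments, so for a linear
    form [l >= 0] on the cone the function
    [s |-> \int cos (s * sqrt l) d(mu - nu)] is flat at the origin, and its
    [k]-th derivative is bounded by the [k]-th absolute moments [M k] of
    [sqrt l]. If [T i] is the last point where [rho <= 2 i], then
    [int_r^t rho(s)/s ds >= \sum_i 2 ln^+ (t / T i)] bounds [M (2 k)] by
    [A c^(2k) \prod_(i <= k) T i ^ 2], and
    [rho s <= 2 + 2 #{i | T i <= s}] turns the divergence of [int rho(s)/s^2 ds]
    into that of [\sum_i 1 / T i], i.e. of [\sum_k M (k-1) / M k]. Bang's
    elementary proof of the Denjoy-Carleman theorem then shows that the function
    vanishes identically; it only uses Taylor's inequality, which integrates from
    the pointwise one for the cosine.
    As [cos (y sqrt (2 / N)) ^ N] tends to [exp (- y ^ 2)] and powers of cosines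
    are combinations of cosines, [mu] and [nu] have the same Laplace transform.
    Indicators of boxes are bounded pointwise limits of polynomials in the
    functions [exp (- x_i)], so the measures agree on boxes. *)

(** * Bang's theorem and Taylor bounds for the cosine *)

Section bang.
Variable R : realType.
Implicit Types (x y s h : R).

Lemma sum_exp_le_expR x m : 0 <= x ->
  \sum_(i < m) x ^+ i / i`!%:R <= expR x.
Proof.
move=> x0.
have nd : nondecreasing_seq (series (exp_coeff x)).
  by apply: nondecreasing_series => i _ _; exact: exp_coeff_ge0.
have := nondecreasing_cvgn_le nd (is_cvg_series_exp_coeff x) m.
by rewrite /series /= big_mkord.
Qed.

Variables (f : nat -> R -> R) (q : nat -> R) (A : R).
Hypothesis A_ge0 : 0 <= A.
Hypothesis q_gt0 : forall j, 0 < q j.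
Hypothesis q_ndecr : forall i j, (i <= j)%N -> q i <= q j.

Let M j := A * \prod_(i < j) q i.

Hypothesis f_taylor : forall j m s h, 0 <= s -> 0 <= h ->
  `|f j (s + h)| <= \sum_(i < m) h ^+ i / i`!%:R * `|f (j + i)%N s|
                    + h ^+ m / m`!%:R * M (j + m)%N.
Hypothesis f_flat : forall j, f j 0 = 0.

Let M_ge0 j : 0 <= M j.
Proof. by rewrite mulr_ge0// prodr_ge0// => i _; exact: ltW. Qed.

(** The [i] factors that [M (j + i)] has beyond [M j] are values of [q] at indices at most [N]. *)
Let MD_le j i N : (j + i <= N.+1)%N -> M (j + i) <= M j * q N ^+ i.
Proof.
elim: i => [|i ih] ji; first by rewrite addn0 expr0 mulr1.
rewrite addnS /M big_ord_recr/= mulrA exprSr mulrA.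
rewrite addnS in ji.
apply: ler_pM => //; [exact: M_ge0 | exact: ltW| |].
- by apply: ih; rewrite (leq_trans _ ji).
- exact: q_ndecr.
Qed.

(** Bang's induction hypothesis: at [s], the derivatives of order below [N] beat the a priori bound
    [M j] by a factor [exp (j - N)]. At order [N] the factor would be 1, which is the a priori bound
    itself. *)
Let good N s :=
  forall j, (j < N)%N -> `|f j s| <= M j * expR (j%:R - N%:R).

(** A move of length at most [1 / (e q N)] costs one index. The Taylor terms are at most
    [M j e^(j - N - 1) (h e q N)^i / i!], and the exponential series of [h e q N <= 1] loses at most
    a factor [e]. *)
Let good_step N s h : 0 <= s -> 0 <= h -> h * (expR 1 * q N) <= 1 ->
  good N.+1 s -> good N (s + h).
Proof.
move=> s0 h0 hq gs j jN.
(* With this order the remainder carries [M N.+1]; since [exp ((j + m) - N.+1) = 1], it fits the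
   pattern of the other terms as the one of index [m]. *)
set m := (N.+1 - j)%N.
have jm : (j + m = N.+1)%N by rewrite subnKC// ltnW// ltnS ltnW.
apply: (le_trans (f_taylor j m s0 h0)).
have h_ge0 i : 0 <= h ^+ i / i`!%:R by rewrite divr_ge0// exprn_ge0.
have e1q0 : 0 <= expR 1 * q N by rewrite mulr_ge0 ?expR_ge0 ?ltW.
have key i : (i <= m)%N -> M (j + i) * expR ((j + i)%:R - N.+1%:R) <=
    M j * expR (j%:R - N.+1%:R) * (expR 1 * q N) ^+ i.
  move=> im.
  have ->: expR ((j + i)%:R - N.+1%:R) = expR (j%:R - N.+1%:R) * expR 1 ^+ i :> R.
    by rewrite -expRM_natl mulr1 -expRD natrD; congr expR; ring.
  rewrite exprMn.
  rewrite (_ : _ * _ * _ = M j * q N ^+ i * (expR (j%:R - N.+1%:R) * expR 1 ^+ i)); last by ring.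
  apply: ler_wpM2r; first by rewrite mulr_ge0 ?expR_ge0// exprn_ge0// expR_ge0.
  by apply: MD_le; rewrite -jm leq_add2l.
apply: (@le_trans _ _ (\sum_(i < m.+1) M j * expR (j%:R - N.+1%:R) *
    ((h * (expR 1 * q N)) ^+ i / i`!%:R))).
  rewrite big_ord_recr/=; apply: lerD.
    apply: ler_sum => i _.
    apply: (@le_trans _ _ (h ^+ i / i`!%:R *
        (M (j + i) * expR ((j + i)%:R - N.+1%:R)))).
      by apply: ler_wpM2l => //; apply: gs; rewrite -jm ltn_add2l.
    rewrite exprMn [in leRHS](mulrAC (h ^+ i)) [leRHS]mulrCA.
    by apply: ler_wpM2l => //; apply: key; exact: ltnW.
  rewrite exprMn [in leRHS](mulrAC (h ^+ m)) [leRHS]mulrCA.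
  apply: ler_wpM2l => //; apply: le_trans (key _ (leqnn m)).
  by rewrite jm subrr expR0 mulr1.
rewrite -mulr_sumr.
have -> : j%:R - N%:R = (j%:R - N.+1%:R) + 1 :> R by rewrite -natr1; ring.
rewrite [X in _ <= _ * X]expRD [leRHS]mulrA; apply: ler_wpM2l; first by rewrite mulr_ge0 ?expR_ge0.
have hq0 : 0 <= h * (expR 1 * q N) by rewrite mulr_ge0.
by apply: (le_trans (sum_exp_le_expR _ hq0)); rewrite ler_expR.
Qed.

(** At the origin [good] holds for every index by flatness. Steps of length [1 / (e q i)], with [i]
    going down from [m + d - 1] to [m], then lead to [s]. *)
Let good_reach d m s : 0 <= s ->
  s <= \sum_(m <= i < m + d) (expR 1 * q i)^-1 -> good m s.
Proof.
elim: d m s => [|d ih] m s s0.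
  rewrite addn0 big_geq// => sle0; have -> : s = 0 by apply/eqP; rewrite eq_le sle0 s0.
  by move=> j _; rewrite f_flat normr0 mulr_ge0 ?expR_ge0.
have e1q i : 0 < expR 1 * q i by rewrite mulr_gt0 ?expR_gt0.
rewrite big_ltn ?addnS ?ltnS ?leq_addr// -addSn => sle.
(* If [s] is closer to 0 than one full step, the step starts at the origin. *)
pose s' := Num.max (s - (expR 1 * q m)^-1) 0.
have s'0 : 0 <= s' by rewrite le_max lexx orbT.
have s's : s' <= s by rewrite ge_max s0 andbT gerBl invr_ge0 ltW.
rewrite -(subrK s' s) addrC; apply: good_step => //; first by rewrite subr_ge0.
  rewrite -ler_pdivlMr// div1r lerBlDl -lerBlDr; by rewrite le_max lexx.
apply: ih => //; rewrite ge_max lerBlDl sle/=.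
by apply: sumr_ge0 => i _; rewrite invr_ge0 ltW.
Qed.

(** Divergence brings every [s] within reach for every index [m], so [|f 0 s| <= A exp (- m)] for
    all positive [m]. *)
Lemma bang_flat : (forall B, exists N, B <= \sum_(i < N) (q i)^-1) ->
  forall s, 0 <= s -> f 0 s = 0.
Proof.
move=> qdiv s s0.
have gs m : good m s.
  (* The surplus over the first [m] terms has to pay for the factor [e] in the step lengths. *)
  have [N HN] := qdiv (\sum_(i < m) (q i)^-1 + expR 1 * s).
  have mN : good m s \/ (m <= N)%N.
    have [?|Nm] := leqP m N; [by right|left].
    have : \sum_(i < N) (q i)^-1 <= \sum_(i < m) (q i)^-1.
      rewrite -!(big_mkord xpredT (fun i => (q i)^-1)).
      rewrite (big_cat_nat _ (ltnW Nm))//= lerDl sumr_ge0// => i _.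
      by rewrite invr_ge0 ltW.
    move=> /(le_trans HN); rewrite gerDl pmulr_rle0 ?expR_gt0// => s_le0.
    apply: (@good_reach 0) => //.
    by rewrite addn0 big_geq.
  case: mN => // mN.
  apply: (@good_reach (N - m)%N) => //.
  rewrite subnKC//.
  under eq_bigr do rewrite invfM.
  rewrite -mulr_sumr mulrC ler_pdivlMr ?expR_gt0// mulrC.
  move: HN; rewrite -!(big_mkord xpredT (fun i => (q i)^-1)).
  by rewrite [X in _ <= X](big_cat_nat _ mN)//= lerD2l.
apply/eqP; rewrite -normr_eq0 eq_le normr_ge0 andbT.
have lim0 : M 0 * expR (- n%:R) @[n --> \oo] --> 0.
  rewrite -[X in _ --> X](mulr0 (M 0)).
  by apply: cvgM; [exact: cvg_cst | exact: cvgn_expR].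
apply: (cvgr_to_ge lim0); near=> n.
have /= := gs n.+1 0%N isT; rewrite sub0r => /le_trans; apply.
by rewrite ler_wpM2l// ler_expR lerN2 ler_nat.
Unshelve. all: by end_near. Qed.

End bang.

(** * Taylor's inequality for the cosine, and the Gaussian as a limit of powers of cosines *)

Section cos_taylor.
Variable R : realType.
Implicit Types (x y : R).

(* The [j]-th derivative of the cosine at [x]. *)
Definition cosd (j : nat) x : R := cos (x + j%:R * (pi / 2)).

Lemma cosd0 x : cosd 0 x = cos x.
Proof. by rewrite /cosd mul0r addr0. Qed.

Lemma cosd_le1 j x : `|cosd j x| <= 1.
Proof. exact: cos_max. Qed.

Lemma cosdS j x : cosd j.+1 x = - sin (x + j%:R * (pi / 2)).
Proof. by rewrite /cosd -natr1 mulrDl mul1r addrA cosDpihalf. Qed.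

Lemma cosd_odd0 j : odd j -> cosd j 0 = 0.
Proof.
move=> oj; rewrite /cosd add0r.
have -> : j%:R * (pi / 2) = pi / 2 + pi *+ j./2 :> R.
  by rewrite -[in LHS](odd_double_half j) oj natrD -mul2n natrM mulr1n -mulr_natr; field.
elim: (j./2) => [|k ih]; first by rewrite mulr0n addr0 cos_pihalf.
by rewrite (mulrSr pi) addrA cosDpi ih oppr0.
Qed.

Global Instance is_derive_cosd j x : is_derive x 1 (cosd j) (cosd j.+1 x).
Proof.
rewrite cosdS /cosd; apply: is_derive_eq.
by rewrite addr0 /GRing.scale/= mulr1.
Qed.

(** Induction on the order: the derivative in [y] of the remainder of order [m.+1] of [cosd j] is
    the remainder of order [m] of [cosd j.+1]. *)
Lemma cosd_taylor j m x y : 0 <= y ->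
  `|cosd j (x + y) - \sum_(i < m) y ^+ i / i`!%:R * cosd (j + i) x|
    <= y ^+ m / m`!%:R.
Proof.
elim: m j y => [|m ih] j y y0.
  by rewrite big_ord0 subr0 expr0 fact0 divr1 cosd_le1.
pose mono k (z : R) := z ^+ k / k`!%:R.
have dmono k (z : R) : is_derive z 1 (mono k.+1) (mono k z).
  have -> : mono k.+1 = k.+1`!%:R^-1 *: (id : R -> R) ^+ k.+1.
    apply/funext => u; rewrite /mono mulrC.
    change (k.+1`!%:R^-1 * u ^+ k.+1 = k.+1`!%:R^-1 * ((id : R -> R) ^+ k.+1) u).
    by rewrite exprfctE.
  apply: is_derive_eq; rewrite /GRing.scale/= mulr1 /mono factS natrM invfM.
  by rewrite mulrA [_^-1 * _ * _]mulrAC mulVf ?mul1r ?pnatr_eq0// mulrC.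
pose p l k z := \sum_(i < k) mono i z * cosd (l + i) x.
have dp k (z : R) : is_derive z 1 (p j k.+1) (p j.+1 k z).
  elim: k => [|k ihk].
    have -> : p j 1%N = cst (cosd j x).
      by apply/funext => u; rewrite /p big_ord_recl big_ord0/= /mono expr0 fact0 divr1 mul1r !addr0 addn0.
    by rewrite /p big_ord0; exact: is_derive_cst.
  have -> : p j k.+2 = p j k.+1 + cosd (j + k.+1) x *: mono k.+1.
    apply/funext => u; rewrite /p big_ord_recr/=.
    by congr (_ + _); rewrite mulrC.
  have -> : p j.+1 k.+1 z = p j.+1 k z + cosd (j + k.+1) x *: mono k z.
    by rewrite /p big_ord_recr/= addSnnS mulrC.
  by apply: is_deriveD.
have dc (z : R) : is_derive z 1 (fun z => cosd j (x + z)) (cosd j.+1 (x + z)).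
  have -> : (fun z => cosd j (x + z)) = cosd j \o shift x.
    by apply/funext => u; rewrite /= addrC.
  rewrite (addrC x) -[X in is_derive _ _ _ X]mulr1.
  exact: (@is_derive1_comp _ (cosd j) (shift x) z _ _ (is_derive_cosd j (z + x)) (is_derive_shift z 1 x)).
(* The signs [e = 1] and [e = -1] give the two halves of the absolute value. The function [g] below
   vanishes at 0 and has a non-negative derivative by induction. *)
have main (e : R) : `|e| = 1 ->
    e * (cosd j (x + y) - p j m.+1 y) <= y ^+ m.+1 / m.+1`!%:R.
  move=> e1.
  pose g z := mono m.+1 z - e * (cosd j (x + z) - p j m.+1 z).
  pose dg z := mono m z - e * (cosd j.+1 (x + z) - p j.+1 m z).
  have dgg (z : R) : is_derive z 1 g (dg z).
    have -> : g = mono m.+1 - e *: ((fun z => cosd j (x + z)) - p j m.+1).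
      by apply/funext => u.
    exact: is_derive_eq.
  have cg : {within `[0, y], continuous g}.
    apply: derivable_within_continuous => z _; exact: (@ex_derive _ _ _ _ _ _ _ (dgg z)).
  have [c] := MVT_segment y0 (fun z _ => dgg z) cg.
  rewrite in_itv/= => /andP[c0 cy] gE.
  have g0 : g 0 = 0.
    rewrite /g {1}/mono expr0n mul0r addr0 /p big_ord_recl big1; last first.
      by move=> i _; rewrite /mono/= expr0n/= !mul0r.
    by rewrite /mono/= expr0 fact0 divr1 mul1r addn0 addr0 subrr mulr0 subr0.
  have gyE : g y = dg c * (y - 0) by rewrite -gE g0 subr0.
  rewrite -subr_ge0 -/(mono m.+1 y) -/(g y) gyE subr0 mulr_ge0//.
  rewrite /dg subr_ge0; apply: le_trans (ih j.+1 c c0).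
  by apply: (le_trans (ler_norm _)); rewrite normrM e1 mul1r.
rewrite ler_norml -[X in X && _]lerN2 opprK -mulN1r main ?normrN1//=.
by rewrite -[leLHS]mul1r main ?normr1.
Qed.

(** Both functions are close to [1 - x^2 / 2], the cosine within [x^4 / 24] and the Gaussian within
    [x^4 / 8]. *)
Lemma cos_expR_approx x : `|cos x - expR (- (x ^+ 2 / 2))| <= x ^+ 4.
Proof.
have exp_approx (u : R) : 0 <= u -> `|expR (- u) - (1 - u)| <= u ^+ 2 / 2.
  move=> u0; rewrite ger0_norm; last by rewrite subr_ge0; exact: expR_ge1Dx.
  rewrite expRN lerBlDr -[leLHS]div1r ler_pdivrMr ?expR_gt0//.
  have u1 : 1 + u + u ^+ 2 / 2 <= expR u.
    apply: le_trans (sum_exp_le_expR 3 u0).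
    rewrite !big_ord_recr big_ord0/= expr0 expr1 fact0 !divr1 add0r.
    by rewrite (_ : 2`! = 2)%N.
  (* This product equals [1 + u^4 / 4]. *)
  apply: (@le_trans _ _ ((u ^+ 2 / 2 + (1 - u)) * (1 + u + u ^+ 2 / 2))).
    by have := sqr_ge0 (u ^+ 2); nra.
  by apply: ler_wpM2l => //; have := sqr_ge0 (1 - u); nra.
have cos_approx : `|cos x - (1 - x ^+ 2 / 2)| <= x ^+ 4 / 24.
  wlog x0 : x / 0 <= x.
    move=> H; have [|/ltW x0] := leP 0 x; first exact: H.
    have := H (- x); rewrite oppr_ge0 => /(_ x0).
    by rewrite cosN sqrrN (_ : (- x) ^+ 4 = x ^+ 4)//; ring.
  have := @cosd_taylor 0 4 0 x x0.
  rewrite !big_ord_recr big_ord0/= !add0n add0r.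
  rewrite (cosd_odd0 (j := 1))// (cosd_odd0 (j := 3))// !mulr0 !addr0.
  rewrite !cosd0 cos0 expr0 fact0 divr1 mul1r add0r.
  rewrite cosdS mul1r add0r sin_pihalf mulrN1.
  by rewrite (_ : 2`! = 2)%N// (_ : 4`! = 24)%N.
have x20 : 0 <= x ^+ 2 / 2 by rewrite divr_ge0// sqr_ge0.
have := exp_approx _ x20; rewrite distrC => e2.
have -> : cos x - expR (- (x ^+ 2 / 2)) = (cos x - (1 - x ^+ 2 / 2)) +
  (1 - x ^+ 2 / 2 - expR (- (x ^+ 2 / 2))) by ring.
apply: (le_trans (ler_normD _ _)); apply: (le_trans (lerD cos_approx e2)).
have := sqr_ge0 (x ^+ 2); nra.
Qed.

Lemma cvg_cosX_expR x :
  cos (x * Num.sqrt (2 / n.+1%:R)) ^+ n.+1 @[n --> \oo] --> expR (- x ^+ 2).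
Proof.
apply/cvgrPdist_le => e e0.
(* Raising to the power [n.+1] multiplies the error by at most [n.+1]. As the error is of fourth
   order in [x * s] and [s^2 = 2 / n.+1], the total is [4 x^4 / n.+1]. *)
have powB (a b : R) k : `|a| <= 1 -> `|b| <= 1 ->
    `|a ^+ k - b ^+ k| <= k%:R * `|a - b|.
  move=> a1 b1; elim: k => [|k ih]; first by rewrite !expr0 subrr normr0 mul0r.
  have -> : a ^+ k.+1 - b ^+ k.+1 = a * (a ^+ k - b ^+ k) + (a - b) * b ^+ k.
    by rewrite !exprS; ring.
  rewrite -natr1 [leRHS]mulrDl mul1r; apply: (le_trans (ler_normD _ _)).
  rewrite !normrM; apply: lerD.
    by apply: le_trans ih; rewrite ler_piMl.
  by rewrite ler_piMr// normrX exprn_ile1.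
near=> n.
set s := Num.sqrt (2 / n.+1%:R).
have s2 : s ^+ 2 = 2 / n.+1%:R by rewrite sqr_sqrtr// divr_ge0.
have n0 : n.+1%:R != 0 :> R by rewrite pnatr_eq0.
have -> : expR (- x ^+ 2) = expR (- ((x * s) ^+ 2 / 2)) ^+ n.+1.
  rewrite -expRM_natl; congr expR; rewrite exprMn s2.
  by field.
rewrite distrC; apply: (le_trans (powB _ _ _ _ _)); first exact: cos_max.
  rewrite ger0_norm ?expR_ge0// -expR0 ler_expR oppr_le0.
  by rewrite divr_ge0// sqr_ge0.
apply: (@le_trans _ _ (n.+1%:R * (x * s) ^+ 4)).
  by rewrite ler_wpM2l// cos_expR_approx.
have -> : (x * s) ^+ 4 = x ^+ 4 * (2 / n.+1%:R) ^+ 2 by rewrite -s2; ring.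
have -> : n.+1%:R * (x ^+ 4 * (2 / n.+1%:R) ^+ 2) = 4 * x ^+ 4 / n.+1%:R by field.
rewrite ler_pdivrMr ?ltr0n// -ler_pdivrMl//.
apply: (@le_trans _ _ n%:R); last by rewrite ler_nat.
by near: n; exact: nbhs_infty_ger.
Unshelve. all: by end_near. Qed.

End cos_taylor.

(** * The weight *)

Section integrals.
Variable R : realType.
Notation leb := (@lebesgue_measure R).

Lemma measurable_inv_itv (a : R) : 0 < a -> measurable_fun `]a, +oo[ (fun s : R => s^-1).
Proof.
move=> a0; apply: open_continuous_measurable_fun; first exact: interval_open.
apply/in_setP => x /=; rewrite in_itv/= andbT => ax.
by apply: cvgV; [rewrite gt_eqF// (lt_trans a0)|exact: cvg_id].
Qed.

Lemma integral_inv_sq (a : R) : 0 < a ->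
  (\int[leb]_(s in `]a, +oo[) (s ^- 2)%:E = (a^-1)%:E)%E.
Proof.
move=> a0.
have cV (x : R) : a <= x -> (fun s : R => s^-1) @ x --> x^-1.
  by move=> ax; apply: cvgV; [rewrite gt_eqF// (lt_le_trans a0)|exact: cvg_id].
have msq : measurable_fun `]a, +oo[ (fun s : R => s ^- 2).
  have -> : (fun s : R => s ^- 2) = (fun s : R => s^-1 ^+ 2).
    by apply/funext => s; rewrite exprVn.
  by apply: measurable_funX; exact: measurable_inv_itv.
rewrite integral_itv_obnd_cbnd; last exact/measurable_EFinP.
rewrite (@ge0_continuous_FTC2y _ _ (fun s : R => - s^-1) _ 0).
- by rewrite EFinN oppeK add0e.
- by move=> x ax; rewrite invr_ge0 sqr_ge0.
- apply: continuous_in_subspaceT => x /[!inE]/= /[!in_itv]/= /andP[ax _].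
  have -> : (fun s : R => s ^- 2) = (fun s : R => s^-1 * s^-1).
    by apply/funext => s; rewrite -exprVn expr2.
  by apply: cvgM; exact: cV.
- rewrite -oppr0; apply: cvgN; apply/gtr0_cvgV0; last exact: cvg_id.
  by near=> s; near: s; exact: nbhs_pinfty_gt.
- move=> x ax; apply: derivableN; apply: derivableV => //.
  by rewrite gt_eqF// (lt_trans a0).
- apply: cvg_at_right_filter; apply: cvgN; exact: cV.
- move=> x /[!in_itv]/= /andP[ax _].
  have x0 : x != 0 by rewrite gt_eqF// (lt_trans a0).
  rewrite derive1E deriveN; last by apply: derivableV.
  by rewrite deriveV// derive_id scaleNr opprK /GRing.scale/= mulr1.
Unshelve. all: by end_near. Qed.

Lemma integral_inv (a b : R) : 0 < a -> a < b ->
  (\int[leb]_(s in `]a, b[) (s^-1)%:E = (ln (b / a))%:E)%E.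
Proof.
move=> a0 ab.
have gt0 x : a <= x -> 0 < x by exact: lt_le_trans.
have cV (x : R) : a <= x -> (fun s : R => s^-1) @ x --> x^-1.
  by move=> ax; apply: cvgV; [rewrite gt_eqF// gt0|exact: cvg_id].
rewrite -(@integral_itv_bndoo _ _ _ _ true false); last first.
  apply/measurable_EFinP; apply: measurable_funS (measurable_inv_itv a0) => //.
  by apply: subset_itvl; rewrite bnd_simp.
rewrite (continuous_FTC2 ab (F := @ln R)).
- by rewrite -EFinB ln_div// posrE// gt0// ltW.
- apply: continuous_in_subspaceT => x /[!inE]/= /[!in_itv]/= /andP[ax _].
  exact: cV.
- split.
  + move=> x /[!in_itv]/= /andP[ax _].
    by apply: ex_derive; apply: is_derive1_ln; rewrite gt0// ltW.
  + by apply: cvg_at_right_filter; exact: continuous_ln.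
  + by apply: cvg_at_left_filter; apply: continuous_ln; rewrite gt0// ltW.
- move=> x /[!in_itv]/= /andP[ax _].
  by rewrite derive1E; apply: derive_val; apply: is_derive1_ln; rewrite gt0// ltW.
Qed.

End integrals.

(** * The levels of [rho]: divergence of their inverses and growth of the weight *)

Section weight.
Variable R : realType.
Notation leb := (@lebesgue_measure R).
Variables (r : R) (rho : R -> R).
Hypothesis r_gt0 : 0 < r.
Hypothesis rho_ge0 : {in `]r, +oo[, forall s, 0 <= rho s}.
Hypothesis rho_ndecr : {in `]r, +oo[ &, {homo rho : s t / s <= t}}.
Hypothesis rho_meas : measurable_fun `]r, +oo[ rho.
Hypothesis rho_div : (\int[leb]_(s in `]r, +oo[) (rho s / s ^+ 2)%:E = +oo)%E.

Let in_r s : (s \in `]r, +oo[) = (r < s).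
Proof. by rewrite in_itv/= andbT. Qed.

Let rho_ge0' s : r < s -> 0 <= rho s.
Proof. by move=> rs; apply: rho_ge0; rewrite in_r. Qed.

Let rho_le s t : r < s -> s <= t -> rho s <= rho t.
Proof.
by move=> rs st; apply: rho_ndecr; rewrite ?in_r// (lt_le_trans rs).
Qed.

Let meas_sq_gt (a : R) : 0 < a -> measurable_fun `]a, +oo[ (fun s : R => s ^- 2).
Proof.
move=> a0; have -> : (fun s : R => s ^- 2) = (fun s : R => s^-1 ^+ 2).
  by apply/funext => s; rewrite exprVn.
by apply: measurable_funX; exact: measurable_inv_itv.
Qed.

Let meas_sq : measurable_fun `]r, +oo[ (fun s : R => s ^- 2).
Proof. exact: meas_sq_gt. Qed.

Let meas_rho_sq : measurable_fun `]r, +oo[ (fun s => (rho s / s ^+ 2)%:E).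
Proof. by apply/measurable_EFinP; exact: measurable_funM. Qed.

Let rho_sq_ge0 s : `]r, +oo[%classic s -> (0 <= (rho s / s ^+ 2)%:E)%E.
Proof.
by rewrite /= in_r => rs; rewrite lee_fin divr_ge0 ?sqr_ge0// rho_ge0'.
Qed.

(** A bounded [rho] would make [rho s / s^2] integrable on the ray. *)
Lemma rho_unbounded B : exists2 u, r < u & B < rho u.
Proof.
apply: contrapT => H.
have Hle s : r < s -> rho s <= Num.max B 0.
  move=> rs; rewrite le_max; have [//|Bs] := leP (rho s) B.
  by exfalso; apply: H; exists s.
suff : (\int[leb]_(s in `]r, +oo[) (rho s / s ^+ 2)%:E < +oo)%E.
  by rewrite rho_div ltxx.
apply: (@le_lt_trans _ _ (\int[leb]_(s in `]r, +oo[)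
    ((Num.max B 0)%:E * (s ^- 2)%:E))%E).
  apply: ge0_le_integral => //.
  - by apply/measurable_EFinP; apply: measurable_funM.
  - move=> s; rewrite /= in_r => rs.
    by rewrite -EFinM lee_fin ler_wpM2r ?invr_ge0 ?sqr_ge0// Hle.
rewrite ge0_integralZl//.
- by rewrite integral_inv_sq// -EFinM ltry.
- by apply/measurable_EFinP.
- by move=> s _; rewrite lee_fin invr_ge0 sqr_ge0.
- by rewrite lee_fin le_max lexx orbT.
Qed.

(* The last point where [rho] is at most [2 (i + 1)], or [r] if there is none. *)
Definition level (i : nat) : R :=
  sup ([set r] `|` [set s | r < s /\ rho s <= i.+1%:R * 2]).

Let level_set_ub i u : r < u -> i.+1%:R * 2 < rho u ->
  ubound ([set r] `|` [set s | r < s /\ rho s <= i.+1%:R * 2]) u.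
Proof.
move=> ru iu s /= [->|[rs si]]; first exact: ltW.
rewrite leNgt; apply/negP => us.
by have := lt_le_trans iu (rho_le ru (ltW us)); rewrite ltNge si.
Qed.

Let level_has_ubound i :
  has_ubound ([set r] `|` [set s | r < s /\ rho s <= i.+1%:R * 2]).
Proof.
have [u ru iu] := rho_unbounded (i.+1%:R * 2).
by exists u; exact: level_set_ub.
Qed.

Lemma level_ge i : r <= level i.
Proof. by apply: (ub_le_sup (level_has_ubound i)); left. Qed.

Lemma level_gt0 i : 0 < level i.
Proof. exact: lt_le_trans (level_ge i). Qed.

Lemma level_lt_rho i s : level i < s -> i.+1%:R * 2 < rho s.
Proof.
move=> is_; rewrite ltNge; apply/negP => si.
have := ub_le_sup (level_has_ubound i) (x := s).
rewrite leNgt is_ => /(_ _)/negP H; apply: H => //; right; split => //.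
exact: le_lt_trans (level_ge i) is_.
Qed.

Lemma rho_le_level i s : r < s -> s < level i -> rho s <= i.+1%:R * 2.
Proof.
move=> rs si.
have ne : ([set r] `|` [set s | r < s /\ rho s <= i.+1%:R * 2]) !=set0.
  by exists r; left.
have [u /= [ur|[ru ui]] su] := sup_gt ne si.
- by have := lt_trans rs su; rewrite ur ltxx.
- by apply: le_trans ui; apply: rho_le => //; exact: ltW.
Qed.

Lemma level_ndecr i j : (i <= j)%N -> level i <= level j.
Proof.
move=> ij; apply: ge_sup; first by exists r; left.
move=> s /= [->|[rs si]]; first exact: level_ge.
apply: (ub_le_sup (level_has_ubound j)); right; split => //.
by apply: (le_trans si); rewrite ler_wpM2r// ler_nat.
Qed.

(** If [level k < s], then [rho s > 2 (k + 1)], which covers all of the first [k + 1] terms at once;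
    otherwise the term of index [k] is 0. *)
Let sum_level_rho k s : r < s ->
  \sum_(i < k) (if level i < s then 2 else 0) <= rho s.
Proof.
move=> rs; elim: k => [|k ih]; first by rewrite big_ord0 rho_ge0'.
rewrite big_ord_recr/=; case: ifPn => [ks|_]; last by rewrite addr0.
apply: le_trans (ltW (level_lt_rho ks)).
have -> : k.+1%:R * 2 = k%:R * 2 + 2 :> R by rewrite -[k.+1%:R]natr1; ring.
rewrite lerD2r.
apply: (le_trans (ler_sum _ (G := fun=> 2) _)).
  by move=> i _; case: ifP.
by rewrite sumr_const card_ord mulr_natl.
Qed.

(** Let [m] be the first index with [s < level m]. Then [rho s <= 2 (m + 1)], and the [m] earlier
    levels all count in the sum. *)
Let rho_le_sum s : r < s -> exists m,
  rho s <= 2 + \sum_(i < m) (if level i <= s then 2 else 0).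
Proof.
move=> rs; have /ex_minnP[m sm mmin] : exists m, s < level m.
  have [u ru su] := rho_unbounded 0.
  have r1 : r < s + 1 by rewrite ltr_wpDr.
  (* The point [s + 1] lies strictly beyond every level that is at most [s]. If the level of this
     index [i] were one, [rho (s + 1) > 2 (i + 1)] would contradict [rho (s + 1) < i + 1]. *)
  exists (Num.truncn (rho (s + 1))).
  rewrite ltNge; apply/negP => ls.
  have /level_lt_rho : level (Num.truncn (rho (s + 1))) < s + 1.
    by rewrite (le_lt_trans ls)// ltrDl.
  apply/negP; rewrite -leNgt.
  apply: (@le_trans _ _ (Num.truncn (rho (s + 1))).+1%:R).
    by apply/ltW/truncnS_gt; exact: rho_ge0'.
  by rewrite ler_peMr// ler1n.
exists m; apply: (le_trans (rho_le_level rs sm)).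
rewrite (eq_bigr (fun=> 2)); last first.
  move=> i _; case: ifPn => //; rewrite -ltNge => /mmin.
  by rewrite leqNgt ltn_ord.
rewrite sumr_const card_ord.
have -> : m.+1%:R * 2 = m%:R * 2 + 2 :> R by rewrite -[m.+1%:R]natr1; ring.
by rewrite addrC mulr_natl.
Qed.

(** If all partial sums were at most [B], integrating [rho_le_sum] against [s^-2] would bound the
    integral of [rho s / s^2] by [2 / r + 2 B]. *)
Lemma level_series_unbounded B :
  exists N, B <= \sum_(i < N) (level i)^-1.
Proof.
apply: contrapT => H.
have HB N : \sum_(i < N) (level i)^-1 <= B.
  by rewrite leNgt; apply/negP => BN; apply: H; exists N; exact: ltW.
pose g i s := (2 * s ^- 2 * \1_(`[level i, +oo[) s)%:E : \bar R.
have g0 i s : (0 <= g i s)%E.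
  by rewrite lee_fin !mulr_ge0// invr_ge0 sqr_ge0.
have mg i : measurable_fun `]r, +oo[ (g i).
  apply/measurable_EFinP; apply: measurable_funM; first exact: measurable_funM.
  exact: measurable_indic.
have intg i : (\int[leb]_(s in `]r, +oo[) g i s <= (2 * (level i)^-1)%:E)%E.
  have -> : (\int[leb]_(s in `]r, +oo[) g i s = \int[leb]_(s in `]r, +oo[)
      ((fun s => 2%:E * (s ^- 2)%:E) \_ `[level i, +oo[) s)%E.
    by apply: eq_integral => s _; rewrite epatch_indic /g !EFinM.
  rewrite -integral_mkcondr.
    apply: (@le_trans _ _ (\int[leb]_(s in `[level i, +oo[) (2%:E * (s ^- 2)%:E))%E).
      apply: ge0_subset_integral => //; first exact: measurableI.
        apply: measurable_funeM; apply/measurable_EFinP.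
        (* The closed ray is placed inside an open one that still avoids 0. *)
        apply: measurable_funS (meas_sq_gt (a := level i / 2) _) => //.
          by apply: subset_itvr; rewrite bnd_simp; have := level_gt0 i; lra.
        by rewrite divr_gt0 ?level_gt0.
      by move=> s _; rewrite -EFinM lee_fin mulr_ge0// invr_ge0 sqr_ge0.
    rewrite -integral_itv_obnd_cbnd; last first.
      by apply: measurable_funeM; apply/measurable_EFinP; exact: meas_sq_gt (level_gt0 i).
    rewrite ge0_integralZl//.
    - by rewrite integral_inv_sq ?level_gt0// EFinM.
    - by apply/measurable_EFinP; exact: meas_sq_gt (level_gt0 i).
    - by move=> s _; rewrite lee_fin invr_ge0 sqr_ge0.
have msum : measurable_fun `]r, +oo[ (fun s => \sum_(i <oo) g i s)%E.
  exact: (@ge0_emeasurable_sum _ _ _ _ g xpredT (fun i s _ _ => g0 i s) (fun i _ => mg i)).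
suff : (\int[leb]_(s in `]r, +oo[) (rho s / s ^+ 2)%:E < +oo)%E.
  by rewrite rho_div ltxx.
apply: (@le_lt_trans _ _ (\int[leb]_(s in `]r, +oo[)
    ((2 * s ^- 2)%:E + \sum_(i <oo) g i s))%E).
  apply: ge0_le_integral => //.
  - apply: emeasurable_funD; first by apply/measurable_EFinP; exact: measurable_funM.
    exact: msum.
  - move=> s; rewrite /= in_r => rs.
    have [m Hm] := rho_le_sum rs.
    apply: (@le_trans _ _ ((2 * s ^- 2)%:E + \sum_(0 <= i < m) g i s))%E; last first.
      by rewrite leeD2l// nneseries_lim_ge.
    rewrite big_mkord /g sumEFin -EFinD lee_fin.
    rewrite [leRHS](_ : _ = (2 + \sum_(i < m) (if level i <= s then 2 else 0)) / s ^+ 2).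
      by rewrite ler_wpM2r// invr_ge0 sqr_ge0.
    rewrite [RHS]mulrDl mulr_suml; congr (_ + _); apply: eq_bigr => i _.
    rewrite indicE mem_setE in_itv/= andbT; case: ifP => _; by rewrite ?mulr1// mulr0 mul0r.
have sq0 s : `]r, +oo[%classic s -> (0 <= (2 * s ^- 2)%:E :> \bar R)%E.
  by move=> _; rewrite lee_fin mulr_ge0// invr_ge0 sqr_ge0.
have msq : measurable_fun `]r, +oo[ (fun s : R => (2 * s ^- 2)%:E).
  by apply/measurable_EFinP; exact: measurable_funM.
have gsum0 s : `]r, +oo[%classic s -> (0 <= \sum_(i <oo) g i s)%E.
  by move=> _; apply: nneseries_ge0.
rewrite (ge0_integralD leb _ sq0 msq gsum0 msum)//.
apply: lte_add_pinfty.
  under eq_integral do rewrite EFinM.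
  rewrite ge0_integralZl//; last 2 first.
  - by apply/measurable_EFinP.
  - by move=> s _; rewrite lee_fin invr_ge0 sqr_ge0.
  by rewrite integral_inv_sq// -EFinM ltry.
rewrite integral_nneseries//.
apply: (@le_lt_trans _ _ (2 * B)%:E); last exact: ltry.
apply: lime_le.
  apply: is_cvg_nneseries => i _ _.
  by apply: integral_ge0.
apply: nearW => N; rewrite big_mkord.
apply: (@le_trans _ _ (\sum_(i < N) (2 * (level i)^-1)%:E)%E).
  by apply: lee_sum => i _; exact: intg.
by rewrite sumEFin lee_fin -mulr_sumr ler_wpM2l.
Qed.

(** Integrating [sum_level_rho] against [1 / s] bounds the exponent below by the sum of the
    [ln ((t / level i)^2)]; the exponential of this sum times the product of the [level i ^ 2] is
    [t^(2 k)]. *)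
Lemma weight_lower_bound t k : r < t ->
  t ^+ (2 * k) <= \prod_(i < k) level i ^+ 2 *
    expR (\int[leb]_(s in `]r, t[) (rho s / s)).
Proof.
move=> rt.
have t0 : 0 < t by exact: lt_trans rt.
have mrho : measurable_fun `]r, t[ (fun s => rho s / s).
  apply: measurable_funM.
    by apply: measurable_funS rho_meas => //; apply: subset_itvl; rewrite bnd_simp.
  by apply: measurable_funS (measurable_inv_itv r_gt0) => //; apply: subset_itvl; rewrite bnd_simp.
have rho_s_ge0 s : `]r, t[%classic s -> 0 <= rho s / s.
  rewrite /= in_itv/= => /andP[rs _].
  by rewrite divr_ge0 ?rho_ge0'// ltW// (lt_trans r_gt0).
(* Finiteness matters because the real-valued integral reads an infinite one as 0. *)
have fin : (\int[leb]_(s in `]r, t[) (rho s / s)%:E < +oo)%E.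
  apply: (@le_lt_trans _ _ (\int[leb]_(s in `]r, t[) (rho t / r)%:E)%E).
    apply: ge0_le_integral => //; first exact/measurable_EFinP.
    move=> s; rewrite /= in_itv/= => /andP[rs st]; rewrite lee_fin.
    apply: ler_pM => //; first exact: rho_ge0'.
    - by rewrite invr_ge0 ltW// (lt_trans r_gt0).
    - by apply: rho_le => //; exact: ltW.
    - by rewrite lef_pV2 ?posrE ?(lt_trans r_gt0 rs)// ltW.
  by rewrite integral_cst//= lebesgue_measure_itv/= lte_fin rt -EFinD -EFinM ltry.
pose g i s := (2 * (s^-1 * \1_(`]level i, +oo[) s))%:E : \bar R.
have mg i : measurable_fun `]r, t[ (g i).
  apply/measurable_EFinP; apply: measurable_funM => //; apply: measurable_funM.
    by apply: measurable_funS (measurable_inv_itv r_gt0) => //; apply: subset_itvl; rewrite bnd_simp.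
  exact: measurable_indic.
have g0 i s : `]r, t[%classic s -> (0 <= g i s)%E.
  rewrite /= in_itv/= => /andP[rs _].
  by rewrite lee_fin !mulr_ge0// invr_ge0 ltW// (lt_trans r_gt0).
have intg i : ((ln ((t / level i) ^+ 2))%:E <= \int[leb]_(s in `]r, t[) g i s)%E.
  (* For a level beyond [t] the logarithm is non-positive and the bound is trivial. *)
  have [it|ti] := ltP (level i) t; last first.
    apply: (@le_trans _ _ 0%E); last by apply: integral_ge0 => s; exact: g0.
    rewrite lee_fin ln_le0// exprn_ile1//.
      by rewrite divr_ge0// ltW// level_gt0.
    by rewrite ler_pdivrMr ?level_gt0// mul1r.
  rewrite lnXn ?divr_gt0 ?level_gt0// -mulr_natl EFinM -integral_inv ?level_gt0//.
  rewrite -ge0_integralZl//; last 2 first.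
  - apply/measurable_EFinP; apply: measurable_funS (measurable_inv_itv (level_gt0 i)) => //.
    by apply: subset_itvl; rewrite bnd_simp.
  - move=> s; rewrite /= in_itv/= => /andP[ls _].
    by rewrite lee_fin invr_ge0 ltW// (lt_trans (level_gt0 i)).
  have -> : `]level i, t[%classic = `]r, t[ `&` `]level i, +oo[ :> set R.
    apply/seteqP; split=> s; rewrite /= !in_itv/= andbT.
      by move=> /andP[ls ->]; rewrite ls (le_lt_trans (level_ge i) ls).
    by move=> [/andP[_ ->]] ->.
  rewrite integral_mkcondr; under eq_integral do rewrite epatch_indic.
  rewrite le_eqVlt; apply/orP; left; apply/eqP; apply: eq_integral => s _.
  by rewrite /g !EFinM muleA.
have sum_le : (\sum_(i < k) (ln ((t / level i) ^+ 2))%:E <=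
    \int[leb]_(s in `]r, t[) (rho s / s)%:E)%E.
  apply: (@le_trans _ _ (\sum_(i < k) \int[leb]_(s in `]r, t[) g i s)%E).
    by apply: lee_sum => i _; exact: intg.
  rewrite -ge0_integral_sum//; [|by move=> i; exact: mg|by move=> i s; exact: g0].
  apply: ge0_le_integral => //.
  - by move=> s rts; apply: sume_ge0 => i _; exact: g0.
  - apply: emeasurable_sum => i; exact: mg.
  - exact/measurable_EFinP.
  move=> s; rewrite /= in_itv/= => /andP[rs _].
  rewrite /g sumEFin lee_fin -mulr_sumr -mulr_sumr mulrCA mulrC.
  rewrite ler_wpM2r ?invr_ge0 ?(ltW (lt_trans r_gt0 rs))//.
  apply: le_trans (sum_level_rho k rs); rewrite mulr_sumr.
  apply: ler_sum => i _; rewrite indicE mem_setE in_itv/= andbT.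
  by case: ifP => _; rewrite ?mulr1 ?mulr0.
rewrite sumEFin in sum_le.
have : \sum_(i < k) ln ((t / level i) ^+ 2) <= \int[leb]_(s in `]r, t[) (rho s / s).
  rewrite -lee_fin /Rintegral fineK//.
  rewrite ge0_fin_numE//; apply: integral_ge0 => s /rho_s_ge0.
  by rewrite lee_fin.
rewrite -ler_expR expR_sum => H.
apply: (@le_trans _ _ (\prod_(i < k) level i ^+ 2 *
    \prod_(i < k) expR (ln ((t / level i) ^+ 2)))).
  rewrite -big_split/= exprM -[k in X in X <= _]card_ord -prodr_const.
  rewrite le_eqVlt; apply/orP; left; apply/eqP; apply: eq_bigr => i _.
  rewrite lnK ?posrE ?exprn_gt0 ?divr_gt0 ?level_gt0// -exprMn mulrC divfK//.
  by rewrite gt_eqF// level_gt0.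
rewrite ler_wpM2l//.
by apply: prodr_ge0 => i _; exact: sqr_ge0.
Qed.

End weight.

(** * Equality of cosine transforms *)

Section integral_gap.
Context d (T : measurableType d) (R : realType).
Variables mu nu : {measure set T -> \bar R}.
Implicit Types f g : T -> R.

Definition integrable2 f : Prop :=
  mu.-integrable setT (EFin \o f) /\ nu.-integrable setT (EFin \o f).

(** Integration against the signed measure [mu - nu]. The real-valued integral is 0 where the
    extended one is infinite, which is why the linearity lemmas ask for [integrable2]. *)
Definition gap f : R := (\int[mu]_x f x - \int[nu]_x f x)%R.

Lemma eq_gap f g : f =1 g -> gap f = gap g.
Proof. by move=> fg; rewrite /gap; congr (_ - _); apply: eq_Rintegral => x _. Qed.

Lemma integrable2D f g : integrable2 f -> integrable2 g ->
  integrable2 (fun x => f x + g x).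
Proof.
move=> [f1 f2] [g1 g2]; split.
- exact: (integrableD _ f1 g1).
- exact: (integrableD _ f2 g2).
Qed.

Lemma integrable2Z k f : integrable2 f -> integrable2 (fun x => k * f x).
Proof. by move=> [f1 f2]; split; [exact: (integrableZl _ k f1)|exact: (integrableZl _ k f2)]. Qed.

Lemma gapD f g : integrable2 f -> integrable2 g ->
  gap (fun x => f x + g x) = gap f + gap g.
Proof. by move=> [f1 f2] [g1 g2]; rewrite /gap !RintegralD//; ring. Qed.

Lemma gapZ k f : integrable2 f -> gap (fun x => k * f x) = k * gap f.
Proof. by move=> [f1 f2]; rewrite /gap !RintegralZl// mulrBr. Qed.

Lemma integrable2_sum (I : Type) (s : seq I) (f : I -> T -> R) :
  (forall i, integrable2 (f i)) -> integrable2 (fun x => \sum_(i <- s) f i x).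
Proof.
move=> fi; elim: s => [|i s ih].
  under eq_fun do rewrite big_nil.
  by split; exact: integrable0.
by under eq_fun do rewrite big_cons; exact: integrable2D.
Qed.

Lemma gap_sum (I : Type) (s : seq I) (f : I -> T -> R) :
  (forall i, integrable2 (f i)) ->
  gap (fun x => \sum_(i <- s) f i x) = \sum_(i <- s) gap (f i).
Proof.
move=> fi; elim: s => [|i s ih].
  under eq_fun do rewrite big_nil.
  by rewrite big_nil /gap !Rintegral_cst// !mul0r subrr.
under eq_fun do rewrite big_cons.
by rewrite big_cons gapD ?ih//; exact: integrable2_sum.
Qed.

Lemma le_integrable2 f g : measurable_fun setT f -> (forall x, `|f x| <= g x) ->
  integrable2 g -> integrable2 f.
Proof.
move=> mf fg [g1 g2].
have H x : setT x -> (`|(EFin \o f) x| <= `|(EFin \o g) x|)%E.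
  by move=> _; rewrite /= lee_fin (le_trans (fg x))// ler_norm.
by split; [apply: le_integrable H g1 | apply: le_integrable H g2] => //;
  exact/measurable_EFinP.
Qed.

Lemma gap_le f g : measurable_fun setT f -> (forall x, `|f x| <= g x) ->
  integrable2 g -> `|gap f| <= \int[mu]_x g x + \int[nu]_x g x.
Proof.
move=> mf fg ig; have [f1 f2] := le_integrable2 mf fg ig.
have [g1 g2] := ig.
apply: (le_trans (ler_normB _ _)); apply: lerD;
  (apply: (le_trans (le_normr_Rintegral _ _)) => //);
  by apply: le_Rintegral => //; exact: integrable_norm.
Qed.

End integral_gap.

(** * Vanishing of the difference of the cosine transforms *)

Section quasianalytic.
Context d (T : measurableType d) (R : realType).
Variables mu nu : {measure set T -> \bar R}.
Variables (t : T -> R) (A : R) (q : nat -> R).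
Hypothesis t_meas : measurable_fun setT t.
Hypothesis t_ge0 : forall x, 0 <= t x.
Hypothesis A_ge0 : 0 <= A.
Hypothesis q_gt0 : forall i, 0 < q i.
Hypothesis q_ndecr : forall i j, (i <= j)%N -> q i <= q j.
Hypothesis q_div : forall B, exists N, B <= \sum_(i < N) (q i)^-1.
Hypothesis moment_eq : forall k,
  (\int[mu]_x (t x ^+ (2 * k))%:E = \int[nu]_x (t x ^+ (2 * k))%:E)%E.
Hypothesis moment_le : forall k,
  (\int[mu]_x (t x ^+ (2 * k))%:E <= (A * \prod_(i < k) q i ^+ 2)%:E)%E.

(** Each [q i] is repeated twice, so that [M (2 * k)] is the assumed bound on the even moments and
    [M (2 * k).+1] is the geometric mean of its two neighbours. *)
Let q' (j : nat) := q j./2.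
Let M (j : nat) := A * \prod_(i < j) q' i.

Let M_even k : M (2 * k) = A * \prod_(i < k) q i ^+ 2.
Proof.
rewrite /M; congr (_ * _); elim: k => [|k ih]; first by rewrite !big_ord0.
rewrite mulnS !addSn add0n !big_ord_recr/= -mulrA ih expr2.
by rewrite /q' mul2n doubleK/= uphalf_double.
Qed.

Let M_odd k : M (2 * k).+1 = q k * M (2 * k).
Proof. by rewrite /M big_ord_recr/= mulrA mulrC /q' mul2n doubleK. Qed.

Let M_evenS k : M (2 * k.+1) = q k ^+ 2 * M (2 * k).
Proof. by rewrite !M_even big_ord_recr/= mulrA mulrC. Qed.

Let pow_meas j : measurable_fun setT (fun x => (t x ^+ j)%:E).
Proof. by apply/measurable_EFinP; exact: measurable_funX. Qed.

Let pow_ge0 j x : (0 <= (t x ^+ j)%:E)%E.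
Proof. by rewrite lee_fin exprn_ge0. Qed.

Let moment_le2 (la : {measure set T -> \bar R}) :
  (forall k, (\int[la]_x (t x ^+ (2 * k))%:E <= (M (2 * k))%:E)%E) ->
  forall j, (\int[la]_x (t x ^+ j)%:E <= (M j)%:E)%E.
Proof.
move=> even_le j; rewrite -(odd_double_half j) -mul2n; set k := j./2.
case: (odd j); rewrite /= ?add0n; last exact: even_le.
rewrite add1n M_odd.
(* AM-GM: [t ^ (2k+1) <= (q t ^ (2k) + t ^ (2k+2) / q) / 2] *)
apply: (@le_trans _ _ (\int[la]_x ((q k / 2)%:E * (t x ^+ (2 * k))%:E +
    ((q k)^-1 / 2)%:E * (t x ^+ (2 * k.+1))%:E))%E).
  apply: ge0_le_integral => //.
    by apply: emeasurable_funD; apply: measurable_funeM; exact: pow_meas.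
  move=> x _; rewrite -!EFinM -EFinD lee_fin.
  have -> : t x ^+ (2 * k).+1 = t x ^+ (2 * k) * t x by rewrite exprSr.
  have -> : t x ^+ (2 * k.+1) = t x ^+ (2 * k) * t x ^+ 2.
    by rewrite -exprD addnC mulnS.
  rewrite (mulrCA ((q k)^-1 / 2)) (mulrC (q k / 2)) -mulrDr ler_wpM2l ?exprn_ge0//.
  rewrite -subr_ge0.
  have -> : q k / 2 + (q k)^-1 / 2 * t x ^+ 2 - t x =
      (q k - t x) ^+ 2 * ((q k)^-1 / 2).
    by field; rewrite gt_eqF// mulr_gt0.
  by rewrite mulr_ge0 ?sqr_ge0// divr_ge0// invr_ge0 ltW.
have qk0 : (0 <= (q k / 2)%:E)%E by rewrite lee_fin divr_ge0// ltW.
have qk0' : (0 <= ((q k)^-1 / 2)%:E)%E by rewrite lee_fin divr_ge0// invr_ge0 ltW.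
rewrite ge0_integralD//; [|by move=> x _; exact: mule_ge0|exact: measurable_funeM
  |by move=> x _; exact: mule_ge0|exact: measurable_funeM].
rewrite !ge0_integralZl//.
apply: (@le_trans _ _ ((q k / 2)%:E * (M (2 * k))%:E +
  ((q k)^-1 / 2)%:E * (M (2 * k.+1))%:E)%E).
  by apply: leeD; apply: lee_wpmul2l => //; exact: even_le.
rewrite M_evenS -!EFinM -EFinD lee_fin le_eqVlt; apply/orP; left; apply/eqP.
by field; rewrite gt_eqF.
Qed.

Let moment_mu j : (\int[mu]_x (t x ^+ j)%:E <= (M j)%:E)%E.
Proof. by apply: moment_le2 => k; rewrite M_even. Qed.

Let moment_nu j : (\int[nu]_x (t x ^+ j)%:E <= (M j)%:E)%E.
Proof. by apply: moment_le2 => k; rewrite M_even -moment_eq. Qed.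

Lemma integrable2_pow j : integrable2 mu nu (fun x => t x ^+ j).
Proof.
split; apply/integrableP; (split; first exact: pow_meas);
  under eq_integral do rewrite /= ger0_norm ?exprn_ge0//.
- exact: le_lt_trans (moment_mu j) (ltry _).
- exact: le_lt_trans (moment_nu j) (ltry _).
Qed.

Let meas_cosd j s : measurable_fun setT (fun x => cosd j (s * t x)).
Proof.
have -> : (fun x => cosd j (s * t x)) = cosd j \o (fun x => s * t x) by [].
apply: measurableT_comp; last exact: measurable_funM.
apply: continuous_measurable_fun => y.
apply: (@continuous_comp _ _ _ (fun z => z + _) (@cos R)).
  by apply: cvgD; [exact: cvg_id|exact: cvg_cst].
exact: continuous_cos.
Qed.

(** The [j]-th derivative of [cos (s * t x)] in [s]. *)
Let G j s x := t x ^+ j * cosd j (s * t x).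

Let measG j s : measurable_fun setT (G j s).
Proof. by apply: measurable_funM => //; exact: measurable_funX. Qed.

Let intG j s : integrable2 mu nu (G j s).
Proof.
apply: le_integrable2 (integrable2_pow j) => // x.
by rewrite normrM ger0_norm ?exprn_ge0// ler_piMr ?exprn_ge0// cosd_le1.
Qed.

(** Apply [cosd_taylor] at each point with increment [h * t x], multiply by [t x ^ j] and integrate.
    The remainder becomes a moment of order [j + m] of each of the two measures, hence the factor
    2. *)
Let taylorG j m s h : 0 <= h ->
  `|gap mu nu (G j (s + h)) -
    \sum_(i < m) h ^+ i / i`!%:R * gap mu nu (G (j + i) s)| <=
  h ^+ m / m`!%:R * (2 * A * \prod_(i < j + m) q' i).
Proof.
move=> h0.
have E : gap mu nu (fun x => G j (s + h) x +
      -1 * \sum_(i < m) (h ^+ i / i`!%:R) * G (j + i)%N s x) =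
    gap mu nu (G j (s + h)) -
    \sum_(i < m) h ^+ i / i`!%:R * gap mu nu (G (j + i) s).
  have int_sum : integrable2 mu nu
      (fun x => \sum_(i < m) (h ^+ i / i`!%:R) * G (j + i)%N s x).
    by apply: integrable2_sum => i; exact: integrable2Z.
  rewrite gapD//; last exact: integrable2Z.
  rewrite gapZ// mulN1r gap_sum; last by move=> i; exact: integrable2Z.
  by under eq_bigr do rewrite gapZ//.
rewrite -E.
have intH : integrable2 mu nu (fun x => h ^+ m / m`!%:R * t x ^+ (j + m)).
  by apply: integrable2Z; exact: integrable2_pow.
apply: (le_trans (gap_le _ _ intH)).
- apply: measurable_funD => //; apply: measurable_funM => //.
  by apply: measurable_sum => i; apply: measurable_funM.
- move=> x; rewrite /G mulN1r.
  have -> : \sum_(i < m) h ^+ i / i`!%:R * (t x ^+ (j + i) * cosd (j + i) (s * t x))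
     = t x ^+ j * \sum_(i < m) (h * t x) ^+ i / i`!%:R * cosd (j + i) (s * t x).
    by rewrite mulr_sumr; apply: eq_bigr => i _; rewrite exprMn exprD; ring.
  rewrite mulrDl -mulrBr normrM ger0_norm ?exprn_ge0//.
  rewrite exprD mulrCA ler_wpM2l ?exprn_ge0//.
  apply: (le_trans (cosd_taylor _ _ _ _)); first by rewrite mulr_ge0.
  by rewrite exprMn mulrAC.
have [pm pn] := integrable2_pow (j + m).
rewrite !RintegralZl// -mulrDr ler_wpM2l ?divr_ge0 ?exprn_ge0//.
rewrite -mulrA mulrDl mul1r; apply: lerD.
- rewrite -lee_fin /Rintegral fineK; first exact: moment_mu.
  exact: integrable_fin_num.
- rewrite -lee_fin /Rintegral fineK; first exact: moment_nu.
  exact: integrable_fin_num.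
Qed.

(** Odd derivatives of the cosine vanish at 0; for even [j] the two moments of order [j] agree. *)
Let flatG j : gap mu nu (G j 0) = 0.
Proof.
rewrite /G; under eq_fun do rewrite mul0r.
have [oj|ej] := boolP (odd j).
  under eq_fun do rewrite cosd_odd0// mulr0.
  by rewrite /gap !Rintegral_cst// !mul0r subrr.
have je : j = (2 * j./2)%N by rewrite mul2n even_halfK.
have [pm pn] := integrable2_pow j.
rewrite /gap !RintegralZr// -mulrBl [X in X * _](_ : _ = 0) ?mul0r//.
by rewrite /Rintegral je moment_eq subrr.
Qed.

Lemma gap_cos s : gap mu nu (fun x => cos (s * t x)) = 0.
Proof.
wlog s0 : s / 0 <= s.
  move=> H; have [|/ltW s0] := leP 0 s; first exact: H.
  rewrite -(H (- s)) ?oppr_ge0//; apply: eq_gap => x.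
  by rewrite mulNr cosN.
have -> : gap mu nu (fun x => cos (s * t x)) = gap mu nu (G 0 s).
  by apply: eq_gap => x; rewrite /G expr0 mul1r cosd0.
apply: (@bang_flat _ (fun j s => gap mu nu (G j s)) q' (2 * A)) => //.
- by rewrite mulr_ge0.
- by move=> j; exact: q_gt0.
- by move=> i j ij; apply: q_ndecr; exact: half_leq.
- move=> j m u h u0 h0.
  rewrite -lerBlDl; apply: le_trans (taylorG j m u h0).
  rewrite lerBlDr -[X in `|X| <= _](subrK
    (\sum_(i < m) h ^+ i / i`!%:R * gap mu nu (G (j + i) u))).
  apply: (le_trans (ler_normD _ _)); rewrite lerD2l.
  apply: (le_trans (ler_norm_sum _ _ _)); apply: ler_sum => i _.
  by rewrite normrM ger0_norm// divr_ge0// exprn_ge0.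
(* Two terms of the series of [q'] correspond to each term of that of [q], so twice as many are
   taken. *)
- move=> B; have [N HN] := q_div B; exists (2 * N)%N.
  apply: (le_trans HN); elim: N {HN} => [|N ih]; first by rewrite !big_ord0.
  rewrite mulnS !addSn add0n !big_ord_recr/= /q' mul2n doubleK/= uphalf_double -addrA.
  rewrite -mul2n.
  by apply: lerD => //; rewrite lerDl invr_ge0 ltW.
Qed.

End quasianalytic.

(** * From cosine transforms to boxes *)

Section finite_measures.
Context d (T : measurableType d) (R : realType).
Variables mu nu : {measure set T -> \bar R}.
Hypothesis mu_fin : (mu setT < +oo)%E.
Hypothesis nu_fin : (nu setT < +oo)%E.
Implicit Types f g : T -> R.

Lemma bounded_integrable2 f (B : R) : measurable_fun setT f ->
  (forall x, `|f x| <= B) -> integrable2 mu nu f.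
Proof.
move=> mf fB.
have bf : [bounded f x | x in setT].
  exists B; split; first exact: num_real.
  by move=> M BM x _ /=; rewrite (le_trans (fB x))// ltW.
by split; exact: measurable_bounded_integrable.
Qed.

(** Dominated convergence: the constant [B] is integrable for finite measures. *)
Lemma gap_cvg (f_ : nat -> T -> R) f (B : R) :
  (forall n, measurable_fun setT (f_ n)) ->
  (forall n x, `|f_ n x| <= B) ->
  (forall x, f_ n x @[n --> \oo] --> f x) ->
  (forall n, gap mu nu (f_ n) = 0) -> gap mu nu f = 0.
Proof.
move=> mf fB ff f0.
have mlim : measurable_fun setT f by apply: measurable_fun_cvg mf _ => x _; exact: ff.
have fB' x : `|f x| <= B.
  apply: (cvgr_to_le (cvg_norm (ff x))); apply: nearW => n; exact: fB.
have cvg_int (la : {measure set T -> \bar R}) : (la setT < +oo)%E ->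
    (\int[la]_x (f_ n x)%:E)%E @[n --> \oo] --> (\int[la]_x (f x)%:E)%E.
  move=> lafin.
  have iB : la.-integrable setT (EFin \o cst B).
    apply: measurable_bounded_integrable => //.
    by exists `|B|; split => // M BM x _ /=; exact: ltW.
  have ae_cvg : {ae la, forall x, setT x ->
      ((f_ n x)%:E)%E @[n --> \oo] --> (f x)%:E}.
    by apply: aeW => x _; apply: cvg_EFin; [exact: nearW|exact: ff].
  have ae_le : {ae la, forall x n, setT x -> (`|(f_ n x)%:E| <= (B%:E))%E}.
    by apply: aeW => x k _; rewrite /= lee_fin.
  have mE (h : T -> R) : measurable_fun setT h -> measurable_fun setT (fun x : T => (h x)%:E).
    by move=> mh; apply/measurable_EFinP.
  by have [_ _] := dominated_convergence measurableT (fun n => mE _ (mf n))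
    (mE _ mlim) ae_cvg iB ae_le.
have eq_int n : (\int[mu]_x (f_ n x)%:E = \int[nu]_x (f_ n x)%:E)%E.
  have [i1 i2] := bounded_integrable2 (mf n) (fB n).
  have := f0 n; rewrite /gap /Rintegral => /eqP; rewrite subr_eq0 => /eqP e.
  have fK (la : {measure set T -> \bar R}) : la.-integrable setT (EFin \o f_ n) ->
      (\int[la]_x (f_ n x)%:E = (fine (\int[la]_x (f_ n x)%:E))%:E)%E.
    by move=> il; rewrite fineK//; exact: integrable_fin_num.
  by rewrite fK// [RHS]fK// e.
have := cvg_int mu mu_fin; under eq_fun do rewrite eq_int.
move=> /(cvg_unique _ (cvg_int nu nu_fin)) e.
by rewrite /gap /Rintegral e ?subrr.
Qed.

(** * From cosines to the Gaussian of [t] *)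

Section laplace.
Variable t : T -> R.
Hypothesis t_meas : measurable_fun setT t.
Hypothesis t_cos : forall s, gap mu nu (fun x => cos (s * t x)) = 0.

Let meas_cos s : measurable_fun setT (fun x => cos (s * t x)).
Proof.
have -> : (fun x => cos (s * t x)) = cos \o (fun x => s * t x) by [].
apply: measurableT_comp; last exact: measurable_funM.
by apply: continuous_measurable_fun; exact: continuous_cos.
Qed.

(** The extra cosine of arbitrary frequency carries the induction: the product formula absorbs one
    more factor [cos (a * t x)] into the frequencies [s + a] and [s - a]. *)
Let gap_cosX N a s : gap mu nu (fun x => cos (a * t x) ^+ N * cos (s * t x)) = 0.
Proof.
elim: N s => [|N ih] s; first by under eq_fun do rewrite expr0 mul1r.
have intg u : integrable2 mu nu (fun x => cos (a * t x) ^+ N * cos (u * t x)).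
  apply: (@bounded_integrable2 _ 1).
    by apply: measurable_funM => //; exact: measurable_funX.
  move=> x; rewrite normrM normrX mulr_ile1 ?exprn_ge0//; last exact: cos_max.
  by rewrite exprn_ile1// cos_max.
rewrite (@eq_gap _ _ _ _ _ _ (fun x => 2^-1 * (
    cos (a * t x) ^+ N * cos ((s + a) * t x)
    + cos (a * t x) ^+ N * cos ((s - a) * t x)))); last first.
  by move=> x; rewrite exprS mulrDl cosD mulrBl cosB; field.
by rewrite gapZ ?gapD ?ih ?addr0 ?mulr0//; exact: integrable2D.
Qed.

Lemma gap_expR_sq : gap mu nu (fun x => expR (- t x ^+ 2)) = 0.
Proof.
pose c n := Num.sqrt (2 / n.+1%:R) : R.
apply: (@gap_cvg (fun n x => cos (c n * t x) ^+ n.+1) _ 1).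
- by move=> n; exact: measurable_funX.
- by move=> n x; rewrite normrX exprn_ile1// cos_max.
- by move=> x; under eq_fun do rewrite mulrC; exact: cvg_cosX_expR.
- move=> n; rewrite -[RHS](gap_cosX n.+1 (c n) 0); apply: eq_gap => x.
  by rewrite mul0r cos0 mulr1.
Qed.

End laplace.

(** * From Laplace transforms to indicators of boxes *)

Section multipliers.
Variables (n : nat) (u : 'I_n -> T -> R).
Hypothesis u_meas : forall i, measurable_fun setT (u i).
Hypothesis u_ge0 : forall i x, 0 <= u i x.

Let E (la : 'I_n -> R) x := expR (- \sum_i la i * u i x).

Hypothesis gap_laplace : forall la : 'I_n -> R, (forall i, 0 <= la i) ->
  gap mu nu (fun x => expR (- \sum_i la i * u i x)) = 0.

Let E_meas la : measurable_fun setT (E la).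
Proof.
apply: (measurableT_comp (@measurable_expR R)); apply: measurable_funN.
by apply: measurable_sum => i; exact: measurable_funM.
Qed.

Let E_le1 (la : 'I_n -> R) x : (forall i, 0 <= la i) -> `|E la x| <= 1.
Proof.
move=> la0; rewrite ger0_norm ?expR_ge0// -expR0 ler_expR oppr_le0.
by apply: sumr_ge0 => i _; rewrite mulr_ge0.
Qed.

(** The bounded densities [f] for which [f mu] and [f nu] have the same Laplace transform in the
    variables [u]. *)
Definition laplace_null f : Prop :=
  [/\ measurable_fun setT f, exists B : R, forall x, `|f x| <= B &
    forall la : 'I_n -> R, (forall i, 0 <= la i) ->
      gap mu nu (fun x => f x * expR (- \sum_i la i * u i x)) = 0].

(** Unlike the vanishing of a gap, this property passes to products, so indicators can be built one
    coordinate at a time. *)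
Definition multiplier g : Prop :=
  forall f, laplace_null f -> laplace_null (fun x => f x * g x).

Lemma laplace_null1 : laplace_null (fun=> 1).
Proof.
split => //; first by exists 1 => x; rewrite normr1.
by move=> la la0; under eq_fun do rewrite mul1r; exact: gap_laplace.
Qed.

Lemma multiplier1 : multiplier (fun=> 1).
Proof. by move=> f; under eq_fun do rewrite mulr1. Qed.

Lemma multiplierM g h : multiplier g -> multiplier h ->
  multiplier (fun x => g x * h x).
Proof. by move=> mg mh f /mg /mh; under eq_fun do rewrite -mulrA. Qed.

Lemma multiplierB1 g : multiplier g -> multiplier (fun x => 1 - g x).
Proof.
move=> mg f fn; have [mf [B fB] f0] := fn.
have [mfg [B' fgB] fg0] := mg _ fn.
have -> : (fun x => f x * (1 - g x)) = (fun x => f x + -1 * (f x * g x)).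
  by apply/funext => x; ring.
split.
- by apply: measurable_funD => //; exact: measurable_funM.
- exists (B + B') => x; rewrite (le_trans (ler_normD _ _))// lerD//.
  by rewrite mulN1r normrN.
- move=> la la0.
  have int (h : T -> R) (C : R) : measurable_fun setT h -> (forall x, `|h x| <= C) ->
      integrable2 mu nu (fun x => h x * E la x).
    move=> mh hC; apply: (@bounded_integrable2 _ C).
      exact: measurable_funM.
    move=> x; rewrite normrM (le_trans _ (hC x))// ler_piMr//; exact: E_le1.
  rewrite (@eq_gap _ _ _ _ _ _ (fun x => f x * E la x +
      -1 * ((f x * g x) * E la x))); last by move=> x; rewrite /E; ring.
  have i1 := int _ _ mf fB; have i2 := int _ _ mfg fgB.
  rewrite gapD//; last exact: integrable2Z.
  by rewrite gapZ// /E f0// fg0// mulr0 addr0.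
Qed.

Lemma multiplierX g k : multiplier g -> multiplier (fun x => g x ^+ k).
Proof.
move=> mg; elim: k => [|k ih]; first by under eq_fun do rewrite expr0; exact: multiplier1.
by under eq_fun do rewrite exprS; exact: multiplierM.
Qed.

Lemma multiplier_prod (I : Type) (s : seq I) (g : I -> T -> R) :
  (forall i, multiplier (g i)) -> multiplier (fun x => \prod_(i <- s) g i x).
Proof.
move=> mg; elim: s => [|i s ih].
  by under eq_fun do rewrite big_nil; exact: multiplier1.
by under eq_fun do rewrite big_cons; exact: multiplierM.
Qed.

(** With the [g_ k] bounded by 1, any bound of [f] dominates all the products, and [gap_cvg] applies
    for each [la]. *)
Lemma multiplier_cvg (g_ : nat -> T -> R) g :
  (forall k, multiplier (g_ k)) -> (forall k x, `|g_ k x| <= 1) ->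
  (forall x, g_ k x @[k --> \oo] --> g x) -> multiplier g.
Proof.
move=> mg g1 gg f fn; have [mf [B fB] f0] := fn.
have fgg x : f x * g_ k x @[k --> \oo] --> f x * g x.
  by apply: cvgM; [exact: cvg_cst|exact: gg].
have fgB k x : `|f x * g_ k x| <= B.
  by rewrite normrM (le_trans _ (fB x))// ler_piMr.
split.
- apply: (measurable_fun_cvg (h := fun k x => f x * g_ k x)).
    by move=> k; have [] := mg k f fn.
  by move=> x _; exact: fgg.
- exists B => x; apply: (cvgr_to_le (cvg_norm (fgg x))); apply: nearW => k.
  exact: fgB.
- move=> la la0; apply: (@gap_cvg (fun k x => f x * g_ k x * E la x) _ B).
  + by move=> k; apply: measurable_funM => //; have [] := mg k f fn.
  + move=> k x; rewrite normrM (le_trans _ (fgB k x))// ler_piMr//.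
    exact: E_le1.
  + by move=> x; apply: cvgM; [exact: fgg|exact: cvg_cst].
  + by move=> k; have [_ _] := mg k f fn; exact.
Qed.

(** The extra exponential only shifts the parameter [la i] by [c], which keeps it non-negative. *)
Lemma multiplier_expR i c : 0 <= c -> multiplier (fun x => expR (- (c * u i x))).
Proof.
move=> c0 f [mf [B fB] f0].
have mexp : measurable_fun setT (fun x => expR (- (c * u i x))).
  apply: (measurableT_comp (@measurable_expR R)); apply: measurable_funN.
  exact: measurable_funM.
split; first exact: measurable_funM.
  exists B => x; rewrite normrM (le_trans _ (fB x))// ler_piMr//.
  by rewrite ger0_norm ?expR_ge0// -expR0 ler_expR oppr_le0 mulr_ge0.
move=> la la0.
pose la' j := la j + (if j == i then c else 0).
rewrite -[RHS](f0 la'); last first.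
  by move=> j; rewrite addr_ge0//; case: ifP.
apply: eq_gap => x; rewrite -mulrA -expRD -opprD; congr (_ * expR (- _)).
rewrite /la'; under [RHS]eq_bigr do rewrite mulrDl.
rewrite big_split/= addrC; congr (_ + _).
rewrite (bigD1 i)//= eqxx big1 ?addr0// => j /negPf ->.
by rewrite mul0r.
Qed.

(* The exponent is about [k exp (k b)] rather than [exp (k b)] so that the limit
   is [0] at [y = b] too. *)
Lemma cvg_step (b y : R) : 0 <= b -> 0 <= y ->
  (1 - expR (- (k%:R * y))) ^+ (Num.truncn (k%:R * expR (k%:R * b))).+1
    @[k --> \oo] --> ((b < y)%R%:R : R).
Proof.
move=> b0 y0.
pose K k := (Num.truncn (k%:R * expR (k%:R * b))).+1.
pose z k := expR (- (k%:R * y)).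
have z0 k : 0 <= z k by exact: expR_ge0.
have z1 k : z k <= 1 by rewrite -expR0 ler_expR oppr_le0 mulr_ge0.
have a0 k : 0 <= k%:R * expR (k%:R * b) by rewrite mulr_ge0// expR_ge0.
have Kgt k : k%:R * expR (k%:R * b) <= (K k)%:R by exact/ltW/truncnS_gt.
have Kle k : (K k)%:R <= k%:R * expR (k%:R * b) + 1.
  by rewrite -natr1 lerD2r truncn_le.
have sq_le (x : R) : 0 <= x -> x ^+ 2 / 2 <= expR x.
  by move=> x0; have := expR_ge1Dxn 1 x0; rewrite (_ : 2`! = 2)%N//; lra.
have [by_|yb] := ltP b y; last first.
  apply/cvgrPdist_le => e e0.
  have expR_small : \forall k \near \oo, expR (- k%:R) <= e.
    have /cvgrPdist_le/(_ _ e0) := @cvgn_expR R.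
    by apply: filterS => k; rewrite sub0r normrN ger0_norm// expR_ge0.
  near=> k.
  rewrite sub0r normrN ger0_norm; last by rewrite exprn_ge0// subr_ge0; exact: z1.
  (* For [y <= b]: [1 - z <= exp (- z)], and [K z >= k exp (k (b - y)) >= k]. *)
  apply: (@le_trans _ _ (expR (- k%:R))).
    apply: (@le_trans _ _ (expR (- z k) ^+ K k)).
      apply: lerXn2r; rewrite ?nnegrE ?subr_ge0 ?expR_ge0 ?z1//.
      exact: expR_ge1Dx.
    rewrite -expRM_natl ler_expR mulrN lerN2.
    apply: (@le_trans _ _ (k%:R * expR (k%:R * b) * z k)).
      rewrite -mulrA -expRD ler_peMr// -expR0 ler_expR subr_ge0.
      by rewrite ler_wpM2l.
    by rewrite ler_wpM2r.
  by near: k; exact: expR_small.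
apply/cvgrPdist_le => e e0.
(* For [b < y], Bernoulli bounds the error by [K z <= k exp (- k (y - b)) + exp (- k y)]. The two
   summands of [C / k] bound these, by [u^2 / 2 <= exp u] and [u <= exp u]. *)
pose C : R := 2 / (y - b) ^+ 2 + y^-1.
have yb0 : 0 < y - b by rewrite subr_gt0.
have y_gt0 : 0 < y by exact: le_lt_trans by_.
near=> k.
have k0 : 0 < k%:R :> R by rewrite ltr0n; near: k; exact: nbhs_infty_gt.
have [w0 w1] : 0 <= 1 - z k /\ 1 - z k <= 1 by rewrite subr_ge0 gerBl z1 z0.
have bern : 1 - (1 - z k) ^+ K k <= (K k)%:R * z k.
  elim: (K k) => [|m ih]; first by rewrite expr0 subrr mul0r.
  rewrite exprS -natr1.
  have : 0 <= (1 - z k) ^+ m <= 1.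
    by rewrite exprn_ge0// exprn_ile1.
  by have := z0 k; have := z1 k; nra.
rewrite ger0_norm; last first.
  by rewrite subr_ge0 exprn_ile1.
apply: (le_trans bern).
apply: (@le_trans _ _ (C / k%:R)); last first.
  rewrite ler_pdivrMr// -ler_pdivrMl//; near: k; exact: nbhs_infty_ger.
apply: (@le_trans _ _ ((k%:R * expR (k%:R * b) + 1) * z k)).
  by rewrite ler_wpM2r.
rewrite mulrDl mul1r /C mulrDl; apply: lerD.
  rewrite -mulrA -expRD (_ : k%:R * b - k%:R * y = - (k%:R * (y - b))); last by ring.
  rewrite expRN ler_pdivrMr ?expR_gt0//.
  have h := sq_le (k%:R * (y - b)) (mulr_ge0 (ltW k0) (ltW yb0)).
  apply: le_trans (ler_wpM2l _ h); last by rewrite !divr_ge0// ?sqr_ge0// ltW.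
  rewrite le_eqVlt; apply/orP; left; apply/eqP; field.
  by rewrite !gt_eqF.
rewrite /z expRN -invfM lef_pV2 ?posrE ?expR_gt0 ?mulr_gt0// mulrC.
by apply: le_trans (expR_ge1Dx _); rewrite lerDr.
Unshelve. all: by end_near. Qed.

Lemma multiplier_gt i b : multiplier (fun x => (b < u i x)%R%:R).
Proof.
(* For negative [b] the indicator is constantly 1, as [u] is non-negative. *)
have [b0|b0] := leP 0 b; last first.
  by under eq_fun do rewrite (lt_le_trans b0 (u_ge0 i _)); exact: multiplier1.
apply: (multiplier_cvg (g_ := fun k x => (1 - expR (- (k%:R * u i x)))
    ^+ (Num.truncn (k%:R * expR (k%:R * b))).+1)).
- move=> k; apply: multiplierX; apply: multiplierB1; exact: multiplier_expR.
- move=> k x.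
  have z1 : expR (- (k%:R * u i x)) <= 1 by rewrite -expR0 ler_expR oppr_le0 mulr_ge0.
  have [w0 w1] : 0 <= 1 - expR (- (k%:R * u i x)) /\ 1 - expR (- (k%:R * u i x)) <= 1.
    by rewrite subr_ge0 gerBl z1 expR_ge0.
  by rewrite ger0_norm ?exprn_ge0// exprn_ile1.
- by move=> x; exact: cvg_step.
Qed.

(** The indicator of the box is a product over [i] of the multipliers [1_(a i < u i)] and
    [1 - 1_(b i < u i)]. It acts on the constant 1, and [la = 0] gives the measures of the box. *)
Lemma laplace_box_eq (a b : 'I_n -> R) :
  mu [set x | forall i, a i < u i x <= b i] =
  nu [set x | forall i, a i < u i x <= b i].
Proof.
set S := [set x | _].
have mS : measurable S.
  rewrite /S (_ : [set x | _] = \bigcap_(i in [set: 'I_n]) (u i @^-1` `]a i, b i])).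
    apply: fin_bigcap_measurable => // i _; rewrite -[X in measurable X]setTI.
    exact: u_meas.
  apply/seteqP; split=> x /= H i; first by move=> _; rewrite /= in_itv/=; exact: H.
  by have := H i I; rewrite /= in_itv.
have : laplace_null (fun x => 1 * \prod_i
    ((a i < u i x)%R%:R * (1 - (b i < u i x)%R%:R))).
  apply: (@multiplier_prod _ _ (fun i x => (a i < u i x)%R%:R *
    (1 - (b i < u i x)%R%:R))); last exact: laplace_null1.
  move=> i; apply: multiplierM; first exact: multiplier_gt.
  by apply: multiplierB1; exact: multiplier_gt.
move=> [_ _ /(_ (fun=> 0) (fun=> lexx _))].
rewrite (@eq_gap _ _ _ _ _ _ (\1_S)); last first.
  move=> x; have -> : \sum_(i < n) 0 * u i x = 0 by rewrite big1// => i _; rewrite mul0r.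
  rewrite mul1r oppr0 expR0 mulr1 indicE.
  have [xS|xS] := boolP (x \in S).
    apply: big1 => i _; move: xS; rewrite inE => /(_ i) /andP[-> bi].
    by rewrite ltNge bi/= subr0 mulr1.
  apply/eqP/prodf_eq0; move: xS; rewrite notin_setE => /existsNP[i /negP ni].
  exists i => //; move: ni; rewrite negb_and -ltNge => /orP[/negPf ->|->].
    by rewrite mul0r.
  by rewrite subrr mulr0.
rewrite /gap /Rintegral !integral_indic// !setIT => /eqP; rewrite subr_eq0 => /eqP e.
have finS (la : {measure set T -> \bar R}) : (la setT < +oo)%E -> la S \is a fin_num.
  move=> lafin; rewrite ge0_fin_numE//; apply: le_lt_trans lafin.
  by apply: le_measure => //; rewrite inE.
by rewrite -(fineK (finS mu mu_fin)) -(fineK (finS nu nu_fin)) e.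
Qed.

End multipliers.
End finite_measures.

(** * Borel sets of R^n and the cone *)

Section borel_rV.
Variables (R : realType) (n : nat).

Lemma continuous_borelRn (f : 'rV[R]_n -> R) : continuous f ->
  measurable_fun setT (f : borelRn R n -> R).
Proof.
move=> /continuousP cf; apply: (measurability _ (RGenOpens.measurableE R)).
move=> _ [_ [a [b ->] <-]]; rewrite setTI.
apply: sub_sigma_algebra; exact/cf/interval_open.
Qed.

Lemma closed_borelRn (C : set 'rV[R]_n) : closed C ->
  measurable (C : set (borelRn R n)).
Proof.
move=> cC; rewrite -[C]setCK; apply: measurableC.
by apply: sub_sigma_algebra; exact: closed_openC.
Qed.

Variables (l : 'I_n -> 'rV[R]_n -> R) (w : 'I_n -> 'rV[R]_n).
Hypothesis l_cont : forall i, continuous (l i).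
Hypothesis coords : forall x, x = \sum_i l i x *: w i.

Definition box (a b : 'I_n -> R) : set 'rV[R]_n :=
  [set x | forall i, a i < l i x <= b i].

Lemma box_measurable a b : measurable (box a b : set (borelRn R n)).
Proof.
rewrite (_ : box a b = \bigcap_(i in [set: 'I_n]) (l i @^-1` `]a i, b i])).
  apply: fin_bigcap_measurable => // i _.
  rewrite -[X in measurable X]setTI.
  by apply: (continuous_borelRn (@l_cont i)).
apply/seteqP; split=> x /= H i; first by move=> _; rewrite /= in_itv/=; exact: H.
by have := H i I; rewrite /= in_itv.
Qed.

(** These boxes form a countable family, fine enough to exhaust open sets. *)
Let grid (k : nat) (z : {ffun 'I_n -> int}) : set 'rV[R]_n :=
  box (fun i => (z i)%:~R / k.+1%:R) (fun i => ((z i)%:~R + 1) / k.+1%:R).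

Lemma open_box_cover (U : set 'rV[R]_n) (x : 'rV[R]_n) : open U -> U x ->
  exists k z, grid k z x /\ grid k z `<=` U.
Proof.
move=> oU Ux.
have [e /= e0 He] : exists2 e : R, 0 < e & forall y,
    (forall i, `|l i x - l i y| <= e) -> U y.
  have /nbhs_ballP[d /= d0 Hd] : nbhs x U by exact: open_nbhs_nbhs.
  (* The summand 1 keeps [W] positive even if the sum is 0, as for [n = 0]. *)
  pose W := \sum_i `|w i| + 1 : R.
  have W0 : 0 < W by rewrite ltr_wpDl// sumr_ge0.
  exists (d / W / 2); first by rewrite !divr_gt0.
  move=> y Hy; apply: Hd; rewrite -ball_normE /=.
  have -> : x - y = \sum_i (l i x - l i y) *: w i.
    rewrite [in LHS](coords x) [in LHS](coords y) -sumrB.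
    by apply: eq_bigr => i _; rewrite scalerBl.
  apply: (le_lt_trans (ler_norm_sum _ _ _)).
  apply: (@le_lt_trans _ _ (\sum_i (d / W / 2) * `|w i|)).
    by apply: ler_sum => i _; rewrite normrZ ler_wpM2r.
  rewrite -mulr_sumr.
  apply: (@le_lt_trans _ _ (d / W / 2 * W)).
    by rewrite ler_wpM2l ?lerDl//; rewrite !divr_ge0// ltW.
  rewrite mulrAC divfK ?gt_eqF//; lra.
pose k := Num.truncn e^-1.
have ke : k.+1%:R^-1 < e.
  by rewrite invf_plt ?posrE//; exact: truncnS_gt.
have k0 : 0 < k.+1%:R :> R by rewrite ltr0n.
(* Boxes are open on the left, so the corner is the ceiling minus 1 rather than the floor. *)
pose z := [ffun i => Num.ceil (l i x * k.+1%:R) - 1].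
have zE i : (z i)%:~R + 1 = (Num.ceil (l i x * k.+1%:R))%:~R :> R.
  by rewrite ffunE intrB subrK.
have gx : grid k z x.
  move=> i; rewrite zE ler_pdivlMr// ceil_ge andbT ltr_pdivrMr//.
  by rewrite ffunE gt_pred_ceil.
exists k, z; split => //.
move=> y gy; apply: He => i; rewrite (le_trans _ (ltW ke))//.
have /andP[] := gx i; have /andP[] := gy i.
rewrite mulrDl mul1r .
move: ((z i)%:~R / k.+1%:R : R) (k.+1%:R^-1 : R) => p q h1 h2 h3 h4.
by rewrite ler_norml; apply/andP; split; lra.
Qed.

(** Boxes are stable under intersection, generate the Borel sets and exhaust the space with finite
    measure, so uniqueness of measures applies. *)
Lemma borelRn_eq (mu nu : {measure set (borelRn R n) -> \bar R}) :
  (mu setT < +oo)%E ->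
  (forall a b, mu (box a b) = nu (box a b)) ->
  forall A : set (borelRn R n), measurable A -> mu A = nu A.
Proof.
move=> mu_fin mn.
pose G : set (set (borelRn R n)) := [set B | exists a b, B = box a b].
pose g (k : nat) := box (fun=> - k%:R) (fun=> k%:R).
have mG : @measurable _ (borelRn R n) = <<s G >>.
  apply/seteqP; split.
    apply: smallest_sub; first exact: smallest_sigma_algebra.
    move=> U oU.
    (* The index set is countable; grid boxes that stick out of [U] are replaced by the empty
       set. *)
    have -> : U = \bigcup_(kz : nat * {ffun 'I_n -> int})
        (if `[< grid kz.1 kz.2 `<=` U >] then grid kz.1 kz.2 else set0).
      apply/seteqP; split=> x.
        move=> Ux; have [k [z [gx gU]]] := open_box_cover oU Ux.
        by exists (k, z) => //=; rewrite asboolT.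
      by move=> [[k z] _] /=; case: asboolP => // gU /gU.
    apply: (@countable_bigcupT_measurable _ (g_sigma_algebraType G)) => //.
    move=> kz; case: ifP => _; last exact: measurable0.
    by apply: sub_sigma_algebra; do 2 eexists; reflexivity.
  apply: smallest_sub; first exact: sigma_algebra_measurable.
  by move=> _ [a [b ->]]; exact: box_measurable.
apply: (measure_unique G g) => //.
- move=> _ _ [a [b ->]] [a' [b' ->]].
  exists (fun i => Num.max (a i) (a' i)), (fun i => Num.min (b i) (b' i)).
  apply/seteqP; split=> x /=.
    move=> [H H'] i; have /andP[h1 h2] := H i; have /andP[h3 h4] := H' i.
    by rewrite gt_max h1 h3 le_min h2 h4.
  move=> H; split=> i; have := H i; rewrite gt_max le_min;
    by move=> /andP[/andP[h1 h2] /andP[h3 h4]]; apply/andP.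
- by move=> k; exists (fun=> - k%:R), (fun=> k%:R).
- apply/seteqP; split => // x _.
  exists (Num.truncn (\sum_i `|l i x|)).+1 => // i.
  have : `|l i x| < (Num.truncn (\sum_i `|l i x|)).+1%:R.
    apply: le_lt_trans (truncnS_gt _).
    by rewrite (bigD1 i)//= lerDl sumr_ge0.
  by rewrite ltr_norml => /andP[-> /ltW].
- by move=> _ [a [b ->]]; exact: mn.
- move=> k; apply: le_lt_trans mu_fin; apply: le_measure; rewrite ?inE//.
  exact: box_measurable.
Qed.

End borel_rV.

Section euclidean.
Variables (R : realType) (n : nat).
Implicit Types x : 'rV[R]_n.

Lemma euclidean_norm_ge0 x : 0 <= euclidean_norm x.
Proof. exact: sqrtr_ge0. Qed.

Lemma coord_le_euclidean_norm x i : `|x ord0 i| <= euclidean_norm x.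
Proof.
rewrite -sqrtr_sqr /euclidean_norm ler_sqrt; last first.
  by apply: sumr_ge0 => j _; exact: sqr_ge0.
by rewrite (bigD1 i)//= lerDl; apply: sumr_ge0 => j _; exact: sqr_ge0.
Qed.

Lemma mx_norm_le_euclidean_norm x : `|x| <= euclidean_norm x.
Proof.
rewrite [leLHS]/Num.Def.normr/= mx_normrE; apply: bigmax_le; first exact: euclidean_norm_ge0.
by move=> [i j] _ /=; rewrite (ord1 i) coord_le_euclidean_norm.
Qed.

Lemma euclidean_norm_continuous : continuous (@euclidean_norm R n).
Proof.
move=> x; apply: (@continuous_comp _ _ _ (fun x => \sum_(i < n) x ord0 i ^+ 2)
  (@Num.sqrt R)); last exact: sqrt_continuous.
apply: cvg_big => [||i _]; [exact: add_continuous|exact: nbhs_filter|].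
apply: (@continuous_comp _ _ _ (fun x : 'rV[R]_n => x ord0 i) (fun y : R => y ^+ 2)).
  exact: coord_continuous.
exact: exprn_continuous.
Qed.

End euclidean.

(** The integral of a non-negative function is the supremum over the simple functions below it, and
    this grows with the function, measurable or not. The exponential weight can thus serve as an
    upper bound. *)
Lemma ge0_le_integral_nomeas d (T : measurableType d) (R : realType)
    (mu : {measure set T -> \bar R}) (D : set T) (f g : T -> \bar R) :
  (forall x, D x -> (0 <= f x)%E) -> (forall x, D x -> (f x <= g x)%E) ->
  (\int[mu]_(x in D) f x <= \int[mu]_(x in D) g x)%E.
Proof.
move=> f0 fg.
have g0 x : D x -> (0 <= g x)%E by move=> Dx; exact: le_trans (f0 x Dx) (fg x Dx).
rewrite !ge0_integralE//=.
apply: le_ereal_sup => _ [h hf <-]; exists h => // x.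
apply: (le_trans (hf x)); rewrite /patch; case: ifP => // xD.
by apply: fg; rewrite -in_setE.
Qed.

Section null_complement.
Context d (T : measurableType d) (R : realType).
Variables (mu : {measure set T -> \bar R}) (C : set T).
Hypothesis mC : measurable C.
Hypothesis mu0 : mu (~` C) = 0%E.

Lemma integral_null_setC (f : T -> \bar R) : measurable_fun setT f ->
  (forall x, (0 <= f x)%E) ->
  (\int[mu]_x f x = \int[mu]_(x in C) f x)%E.
Proof.
move=> mf f0; rewrite (ge0_negligible_integral (N := ~` C))//.
- by rewrite setTD setCK.
- exact: measurableC.
Qed.

Lemma measure_eq_trace (A B : set T) : measurable A -> measurable B ->
  A `&` C = B `&` C -> mu A = mu B.
Proof.
have E S : measurable S -> mu S = mu (S `&` C).
  move=> mS; rewrite (measureDI mu mS mC) [X in (X + _)%E](_ : _ = 0%E) ?add0e//.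
  by apply: (subset_measure0 (measurableD mS mC) (measurableC mC) _ mu0) => x [].
by move=> mA mB AB; rewrite E// AB -E.
Qed.

End null_complement.

(** * Moments of [mu] bounded by products of levels *)

Section moments.
Variables (R : realType) (n : nat).
Variables (mu : {measure set (borelRn R n) -> \bar R}).
Hypothesis mu_locfin : locally_finite mu.
Variables (r : R) (rho : R -> R).
Hypothesis r_gt0 : 0 < r.
Hypothesis rho_ge0 : {in `]r, +oo[, forall s, 0 <= rho s}.
Hypothesis rho_ndecr : {in `]r, +oo[ &, {homo rho : s t / s <= t}}.
Hypothesis rho_meas : measurable_fun `]r, +oo[ rho.
Hypothesis rho_div :
  (\int[lebesgue_measure]_(s in `]r, +oo[) (rho s / s ^+ 2)%:E = +oo)%E.
Hypothesis mu_exp :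
  (\int[mu]_(x in [set x : 'rV[R]_n | (r < Num.sqrt (euclidean_norm x))%R])
     (expR (\int[lebesgue_measure]_(s in
              `]r, Num.sqrt (euclidean_norm x)[) (rho s / s)%R)%R)%:E
   < +oo)%E.

Let D : set (borelRn R n) := [set x | r < Num.sqrt (euclidean_norm x)].

Let sqrt_norm_cont :
  continuous ((fun x => Num.sqrt (euclidean_norm x)) : 'rV[R]_n -> R).
Proof.
move=> x; apply: (@continuous_comp _ _ _ (@euclidean_norm R n) (@Num.sqrt R)).
  exact: euclidean_norm_continuous.
exact: sqrt_continuous.
Qed.

Let norm_meas k : measurable_fun setT
  (fun x : borelRn R n => (euclidean_norm x ^+ k)%:E).
Proof.
apply/measurable_EFinP; apply: measurable_funX.
exact: (continuous_borelRn (@euclidean_norm_continuous R n)).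
Qed.

Let D_open : open [set x : 'rV[R]_n | r < Num.sqrt (euclidean_norm x)].
Proof.
by have /continuousP H := sqrt_norm_cont; exact: (H _ (@open_gt _ r)).
Qed.

Let mD : measurable D.
Proof. exact: sub_sigma_algebra. Qed.

(** The complement of [D] is a closed ball, hence compact, and local finiteness applies. *)
Let DC_fin : (mu (~` D) < +oo)%E.
Proof.
apply: mu_locfin; apply: bounded_closed_compact.
  exists (r ^+ 2); split; first exact: num_real.
  move=> M rM x /= /negP; rewrite -leNgt => xr.
  apply: (le_trans (mx_norm_le_euclidean_norm x)); apply: le_trans (ltW rM).
  rewrite -(sqr_sqrtr (euclidean_norm_ge0 x)); apply: lerXn2r => //; rewrite nnegrE.
    exact: sqrtr_ge0.
  exact: ltW.
exact: open_closedC.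
Qed.

(** Off [D], the square root of the norm is at most [r], hence at most every level, and the mass is
    finite. On [D], [weight_lower_bound] with this square root as [t] compares the power with the
    integrable weight. *)
Lemma norm_moment_le : exists2 K : R, 0 <= K & forall k,
  (\int[mu]_x (euclidean_norm x ^+ k)%:E <=
    (K * \prod_(i < k) level r rho i ^+ 2)%:E)%E.
Proof.
have := mu_exp; set Ie := (X in (X < _)%E) => Ie_fin.
have Ie0 : (0 <= Ie)%E by apply: integral_ge0 => x _; rewrite lee_fin expR_ge0.
have m0 : (0 <= mu (~` D))%E by exact: measure_ge0.
exists (fine (mu (~` D)) + fine Ie); first by rewrite addr_ge0 ?fine_ge0.
move=> k; set P := \prod_(i < k) _.
have lev_ge i : r <= level r rho i by exact: level_ge.
have P0 : 0 < P.
  by apply: prodr_gt0 => i _; rewrite exprn_gt0// (lt_le_trans r_gt0).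
have PE : (P * P^-1) = 1 by rewrite divff// gt_eqF.
have norm0 x : 0 <= euclidean_norm x ^+ k by rewrite exprn_ge0// euclidean_norm_ge0.
have disj : [disjoint ~` D & D] by rewrite disj_set2E setICl.
rewrite -(setvU D) (ge0_integral_setU mu (measurableC mD) mD)//; last 2 first.
- by rewrite setvU; exact: norm_meas.
- by move=> x _; rewrite lee_fin; exact: norm0.
rewrite mulrDl EFinD; apply: leeD.
  apply: (@le_trans _ _ (\int[mu]_(x in ~` D) P%:E)%E).
    apply: ge0_le_integral_nomeas => x; first by move=> _; rewrite lee_fin; exact: norm0.
    move=> /negP; rewrite -leNgt => xr; rewrite lee_fin.
    rewrite -(sqr_sqrtr (euclidean_norm_ge0 x)) /P -exprM.
    rewrite exprM -[k in X in X <= _]card_ord -prodr_const.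
    apply: ler_prod => i _; rewrite sqr_ge0/= lerXn2r ?nnegrE ?sqrtr_ge0//.
      by rewrite (le_trans (ltW r_gt0)).
    exact: le_trans xr _.
  rewrite integral_cst; last exact: measurableC.
  by rewrite EFinM fineK ?ge0_fin_numE// [leRHS]muleC.
rewrite EFinM fineK ?ge0_fin_numE// muleC.
(* The factor [P] is taken out on the side of the norm, which is measurable, rather than from the
   weight. *)
have -> : (\int[mu]_(x in D) (euclidean_norm x ^+ k)%:E =
    P%:E * \int[mu]_(x in D) (P^-1 * euclidean_norm x ^+ k)%:E)%E.
  rewrite -ge0_integralZl//.
  - apply: eq_integral => x _.
    by rewrite -EFinM mulrA PE mul1r.
  - apply: measurable_funTS; apply/measurable_EFinP; apply: measurable_funM => //.
    by apply: measurable_funX; exact: (continuous_borelRn (@euclidean_norm_continuous R n)).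
  - by move=> x _; rewrite lee_fin mulr_ge0 ?norm0// invr_ge0 ltW.
  - by rewrite lee_fin ltW.
apply: lee_wpmul2l; first by rewrite lee_fin ltW.
apply: ge0_le_integral_nomeas => x Dx; rewrite lee_fin.
  by rewrite mulr_ge0 ?norm0// invr_ge0 ltW.
rewrite mulrC ler_pdivrMr// mulrC.
rewrite -(sqr_sqrtr (euclidean_norm_ge0 x)) -exprM sqr_sqrtr ?euclidean_norm_ge0//.
exact: weight_lower_bound.
Qed.

End moments.

Section cone.
Variables (R : realType) (n : nat) (v : n.-tuple 'rV[R]_n).
Hypothesis v_basis : basis_of fullv v.

Lemma coord_basisE x : x = \sum_i coord v i x *: tnth v i.
Proof.
rewrite {1}(coord_basis v_basis (memvf x)).
by apply: eq_bigr => i _; rewrite (tnth_nth 0).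
Qed.

Lemma positive_coneE : positive_cone v = [set x | forall i, 0 <= coord v i x].
Proof.
apply/seteqP; split=> x /=.
  move=> [a a0 ->] i.
  under eq_bigr do rewrite (tnth_nth 0).
  by rewrite coord_sum_free ?(basis_free v_basis).
by move=> x0; exists (fun i => coord v i x) => //; exact: coord_basisE.
Qed.

Lemma coord_sumE i x : coord v i x = \sum_j x ord0 j * coord v i (delta_mx ord0 j).
Proof.
by rewrite {1}(row_sum_delta x) linear_sum; apply: eq_bigr => j _; rewrite linearZ.
Qed.

Lemma coord_cont i : continuous (coord v i : 'rV[R]_n -> R).
Proof.
pose c j : R := coord v i (delta_mx ord0 j).
have cc j : continuous (fun x : 'rV[R]_n => x ord0 j * c j).
  move=> x; apply: (@continuousM R 'rV[R]_n (fun x => x ord0 j) (fun=> c j)).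
    exact: coord_continuous.
  exact: cst_continuous.
suff : continuous (fun x : 'rV[R]_n => \sum_j x ord0 j * c j).
  rewrite (_ : (fun x => _) = (coord v i : 'rV[R]_n -> R))//.
  by apply/funext => x; rewrite coord_sumE.
move=> x; apply: cvg_big => [||j _]; [exact: add_continuous|exact: nbhs_filter|].
exact: cc.
Qed.

Lemma positive_cone_closed : closed (positive_cone v).
Proof.
rewrite positive_coneE (_ : [set x | _] =
    \bigcap_(i in [set: 'I_n]) (coord v i @^-1` [set y : R | 0 <= y])); last first.
  by apply/seteqP; split=> x H i; [move=> _|]; exact: H.
apply: closed_bigI => i _.
by apply: closed_comp (@closed_ge _ 0) => x _; exact: coord_cont.
Qed.

Lemma coord_le_norm i x : `|coord v i x| <=
  (\sum_j `|coord v i (delta_mx ord0 j)|) * euclidean_norm x.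
Proof.
rewrite coord_sumE; apply: (le_trans (ler_norm_sum _ _ _)).
rewrite mulr_suml; apply: ler_sum => j _.
by rewrite normrM mulrC ler_wpM2l// coord_le_euclidean_norm.
Qed.

End cone.

(** * Determinacy *)

Module LinearFormPower.
Import -(notations) mpoly.

Lemma polyfun_linear_formX (R : realType) (n k : nat) (c : 'I_n -> R) :
  exists P : mpoly.mpoly n R, forall x : 'rV[R]_n,
    (\sum_j x ord0 j * c j) ^+ k = polyfun P x.
Proof.
exists ((\sum_j c j *: mpolyX R (mnm1 j)) ^+ k) => x.
rewrite /polyfun rmorphXn/=; congr (_ ^+ k).
rewrite raddf_sum/=; apply: eq_bigr => j _.
by rewrite mevalZ mevalXU mulrC.
Qed.

End LinearFormPower.

(** * Equality of two measures on the cone with the same moments *)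

Section uniqueness.
Variables (R : realType) (n : nat) (v : n.-tuple 'rV[R]_n).
Hypothesis v_basis : basis_of fullv v.
Variables (mu nu : {measure set (borelRn R n) -> \bar R}).
Notation C := (positive_cone v).
Hypothesis mu_supp : supported_in C mu.
Hypothesis nu_supp : supported_in C nu.
Hypothesis mu_fin : (mu setT < +oo)%E.
Hypothesis nu_fin : (nu setT < +oo)%E.
Hypothesis poly_eq : forall P : mpoly.mpoly n R,
  (\int[nu]_(x in C) (polyfun P x)%:E = \int[mu]_(x in C) (polyfun P x)%:E)%E.
Variables (K : R) (lev : nat -> R).
Hypothesis K_ge0 : 0 <= K.
Hypothesis lev_gt0 : forall i, 0 < lev i.
Hypothesis lev_ndecr : forall i j, (i <= j)%N -> lev i <= lev j.
Hypothesis lev_div : forall B, exists N, B <= \sum_(i < N) (lev i)^-1.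
Hypothesis moment_le : forall k, (\int[mu]_x (euclidean_norm x ^+ k)%:E <=
  (K * \prod_(i < k) lev i ^+ 2)%:E)%E.

(** Truncation makes the coordinates non-negative everywhere and leaves them unchanged on the cone,
    which carries both measures. *)
Let u (i : 'I_n) (x : borelRn R n) : R := Num.max (coord v i x) 0.

Let u_meas i : measurable_fun setT (u i).
Proof.
apply: measurable_maxr => //.
by apply: continuous_borelRn; exact: coord_cont.
Qed.

Let u_ge0 i x : 0 <= u i x.
Proof. by rewrite /u le_max lexx orbT. Qed.

Let mC : measurable (C : set (borelRn R n)).
Proof. by apply: closed_borelRn; exact: positive_cone_closed. Qed.

Let u_cone i x : C x -> u i x = coord v i x.
Proof. by rewrite positive_coneE// => /(_ i) x0; rewrite /u; exact/max_idPl. Qed.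

Let poly_of (la : 'I_n -> R) k : exists P : mpoly.mpoly n R, forall x,
  (\sum_i la i * coord v i x) ^+ k = polyfun P x.
Proof.
have [P HP] := LinearFormPower.polyfun_linear_formX k
  (fun j => \sum_i la i * coord v i (delta_mx ord0 j)).
exists P => x; rewrite -HP; congr (_ ^+ k).
under eq_bigr do rewrite coord_sumE mulr_sumr.
rewrite exchange_big/=; apply: eq_bigr => j _; rewrite mulr_sumr.
by apply: eq_bigr => i _; rewrite mulrCA.
Qed.

(** For the form [l] built from [la], [gap_cos] applies to [t = sqrt l]: the even powers of [t] are
    polynomials on the cone, and [l x <= c^2 * euclidean_norm x] turns the moment bound into one
    with [c * lev i]. Then [exp (- t^2)] is the Laplace kernel. *)
Let laplace_eq (la : 'I_n -> R) : (forall i, 0 <= la i) ->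
  gap mu nu (fun x => expR (- \sum_i la i * u i x)) = 0.
Proof.
move=> la0.
pose l (x : borelRn R n) := \sum_i la i * u i x.
have l0 x : 0 <= l x by apply: sumr_ge0 => i _; rewrite mulr_ge0.
have l_meas : measurable_fun setT l.
  by apply: measurable_sum => i; exact: measurable_funM.
have [c c0 cl] : exists2 c : R, 0 < c & forall x, l x <= c ^+ 2 * euclidean_norm x.
  pose b i := \sum_j `|coord v i (delta_mx ord0 j)|.
  have b0 i : 0 <= b i by exact: sumr_ge0.
  (* The summand 1 makes [c] positive even for [la = 0]. *)
  have S0 : 0 < \sum_i la i * b i + 1.
    by rewrite ltr_wpDl// sumr_ge0// => i _; rewrite mulr_ge0.
  exists (Num.sqrt (\sum_i la i * b i + 1)); first by rewrite sqrtr_gt0.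
  move=> x; rewrite sqr_sqrtr ?(ltW S0)// mulrDl mul1r ler_wpDr ?euclidean_norm_ge0//.
  rewrite mulr_suml; apply: ler_sum => i _; rewrite -mulrA ler_wpM2l//.
  rewrite /u ge_max mulr_ge0 ?euclidean_norm_ge0// andbT.
  exact: le_trans (ler_norm _) (coord_le_norm v i x).
pose t x := Num.sqrt (l x).
have t2 x k : t x ^+ (2 * k) = l x ^+ k by rewrite exprM sqr_sqrtr.
have t_meas : measurable_fun setT t.
  apply: measurableT_comp l_meas; apply: continuous_measurable_fun.
  exact: sqrt_continuous.
have lk_meas k : measurable_fun setT (fun x => (l x ^+ k)%:E).
  by apply/measurable_EFinP; exact: measurable_funX.
have lk0 k x : (0 <= (l x ^+ k)%:E)%E by rewrite lee_fin exprn_ge0.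
have l_poly k : exists P : mpoly.mpoly n R, forall x, C x -> l x ^+ k = polyfun P x.
  have [P HP] := poly_of la k; exists P => x Cx; rewrite -HP; congr (_ ^+ k).
  by apply: eq_bigr => i _; rewrite u_cone.
rewrite (@eq_gap _ _ _ _ _ _ (fun x => expR (- t x ^+ 2))); last first.
  by move=> x; rewrite /t sqr_sqrtr.
apply: gap_expR_sq => //.
apply: (@gap_cos _ _ _ mu nu t K (fun i => c * lev i)) => //.
- by move=> x; exact: sqrtr_ge0.
- by move=> i; exact: mulr_gt0.
- by move=> i j ij; rewrite ler_wpM2l ?lev_ndecr// ltW.
- move=> B; have [N HN] := lev_div (c * B); exists N.
  under eq_bigr do rewrite invfM.
  by rewrite -mulr_sumr ler_pdivlMl.
- move=> k; under eq_integral do rewrite t2.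
  under [RHS]eq_integral do rewrite t2.
  rewrite (integral_null_setC mC mu_supp)// (integral_null_setC mC nu_supp)//.
  have [P HP] := l_poly k.
  transitivity (\int[mu]_(x in C) (polyfun P x)%:E)%E.
    by apply: eq_integral => x /set_mem Cx; rewrite HP.
  rewrite -poly_eq; apply: eq_integral => x /set_mem Cx; by rewrite HP.
- move=> k; under eq_integral do rewrite t2.
  apply: (@le_trans _ _ (\int[mu]_x ((c ^+ (2 * k))%:E * (euclidean_norm x ^+ k)%:E))%E).
    apply: ge0_le_integral_nomeas => x _ //.
    rewrite -EFinM lee_fin exprM -exprMn lerXn2r ?nnegrE//.
    by rewrite mulr_ge0 ?sqr_ge0// euclidean_norm_ge0.
  have ck0 : 0 <= c ^+ (2 * k) by rewrite exprn_ge0// ltW.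
  rewrite ge0_integralZl//; last 2 first.
  - apply/measurable_EFinP; apply: measurable_funX.
    exact: (continuous_borelRn (@euclidean_norm_continuous R n)).
  - by move=> x _; rewrite lee_fin exprn_ge0// euclidean_norm_ge0.
  apply: (@le_trans _ _ ((c ^+ (2 * k))%:E * (K * \prod_(i < k) lev i ^+ 2)%:E)%E).
    by apply: lee_wpmul2l.
  rewrite -EFinM lee_fin le_eqVlt; apply/orP; left; apply/eqP.
  rewrite mulrCA exprM; congr (_ * _).
  under [RHS]eq_bigr do rewrite exprMn.
  by rewrite [RHS]big_split/= big_const_ord iter_mulr_1.
Qed.

(** A box in the coordinates and the box with the same bounds in [u] have the same trace on the
    cone, so [laplace_box_eq] yields equality on all boxes. *)
Lemma cone_measure_eq (A : set (borelRn R n)) : measurable A -> nu A = mu A.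
Proof.
move=> mA; apply/esym; move: A mA.
apply: (@borelRn_eq R n (fun i x => coord v i x) (tnth v) (@coord_cont R n v)
  (coord_basisE v_basis) mu nu mu_fin) => a b.
have mbox : measurable [set x | forall i, a i < u i x <= b i].
  rewrite (_ : [set x | _] = \bigcap_(i in [set: 'I_n]) (u i @^-1` `]a i, b i])).
    apply: fin_bigcap_measurable => // i _; rewrite -[X in measurable X]setTI.
    exact: u_meas.
  apply/seteqP; split=> x /= H i; first by move=> _; rewrite /= in_itv/=; exact: H.
  by have := H i I; rewrite /= in_itv.
have trace : box (fun i x => coord v i x) a b `&` C = [set x | forall i, a i < u i x <= b i] `&` C.
  by apply/seteqP; split=> x [H Cx]; split=> // i; have := H i; rewrite u_cone.
have mb := @box_measurable R n (fun i x => coord v i x) (@coord_cont R n v) a b.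
rewrite (measure_eq_trace mC mu_supp mb mbox trace).
rewrite (measure_eq_trace mC nu_supp mb mbox trace).
exact: laplace_box_eq.
Qed.

End uniqueness.

(** The moment of exponent 0 is the total mass, as the power of exponent 0 is 1 even at the
    origin. *)
Lemma Mstar_fin (R : realType) (n : nat)
    (mu : {measure set (borelRn R n) -> \bar R}) : Mstar mu -> (mu setT < +oo)%E.
Proof.
move=> /(_ 0 (lexx _)).
by under eq_integral do rewrite powRr0; rewrite integral_cst// mul1e.
Qed.

Lemma moments_Mstar (R : realType) (n : nat)
    (mu : {measure set (borelRn R n) -> \bar R}) :
  (forall k, (\int[mu]_x (euclidean_norm x ^+ k)%:E < +oo)%E) -> Mstar mu.
Proof.
(* Since [d < k], the power [d] of the norm is at most 1 plus its power [k]. *)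
move=> mom d d0; pose k := (Num.truncn d).+1.
have nm j : measurable_fun setT
    (fun x : borelRn R n => (euclidean_norm x ^+ j)%:E).
  apply/measurable_EFinP; apply: measurable_funX.
  exact: (continuous_borelRn (@euclidean_norm_continuous R n)).
have n0 j (x : borelRn R n) : (0 <= (euclidean_norm x ^+ j)%:E)%E.
  by rewrite lee_fin exprn_ge0// euclidean_norm_ge0.
apply: (@le_lt_trans _ _ (\int[mu]_x ((euclidean_norm x ^+ 0)%:E +
    (euclidean_norm x ^+ k)%:E))%E); last first.
  by rewrite ge0_integralD//; exact: lte_add_pinfty.
apply: ge0_le_integral_nomeas => x _; first by rewrite lee_fin powR_ge0.
rewrite -EFinD lee_fin expr0.
have N0 := euclidean_norm_ge0 x.
have [N1|N1] := leP 1 (euclidean_norm x).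
  rewrite ler_wpDl// -powR_mulrn// ler_powR//; exact/ltW/truncnS_gt.
rewrite ler_wpDr ?exprn_ge0//.
apply: (@le_trans _ _ (1 `^ d)); last by rewrite powR1.
by rewrite ge0_ler_powR ?nnegrE// ltW.
Qed.

Theorem theorem1p3 (R : realType) (n : nat) (v : n.-tuple 'rV[R]_n)
    (v_basis : basis_of fullv v)
    (mu : {measure set (borelRn R n) -> \bar R})
    (mu_locfin : locally_finite mu)
    (mu_supp : supported_in (positive_cone v) mu)
    (r : R) (r_gt0 : 0 < r) (rho : R -> R)
    (rho_ge0 : {in `]r, +oo[, forall s, 0 <= rho s})
    (rho_ndecr : {in `]r, +oo[ &, {homo rho : s t / s <= t}})
    (rho_C1 : C1_after r rho)
    (rho_div :
      (\int[lebesgue_measure]_(s in `]r, +oo[) (rho s / s ^+ 2)%:E = +oo)%E)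
    (mu_exp :
      (\int[mu]_(x in [set x : 'rV[R]_n | (r < Num.sqrt (euclidean_norm x))%R])
         (expR (\int[lebesgue_measure]_(s in
                  `]r, Num.sqrt (euclidean_norm x)[) (rho s / s)%R)%R)%:E
       < +oo)%E) :
  determinate (positive_cone v) mu.
Proof.
have rho_meas : measurable_fun `]r, +oo[ rho.
  apply: open_continuous_measurable_fun; first exact: interval_open.
  move=> s; rewrite inE /= => rs.
  by apply/differentiable_continuous/derivable1_diffP; exact: rho_C1.1.
have [K K0 HK] := norm_moment_le mu_locfin r_gt0 rho_ge0 rho_ndecr rho_meas rho_div mu_exp.
have mu_Mstar : Mstar mu.
  by apply: moments_Mstar => k; exact: le_lt_trans (HK k) (ltry _).
split => // nu nu_Mstar nu_supp poly_eq A mA.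
apply: (cone_measure_eq v_basis mu_supp nu_supp (Mstar_fin mu_Mstar)
  (Mstar_fin nu_Mstar) poly_eq K0 _ _ _ HK) => //.
- by move=> i; exact: level_gt0.
- by move=> i j; exact: level_ndecr.
- exact: level_series_unbounded.
Qed.
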